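(* Let $\ell:\mathfrak{d}(\mathbb{M})\times \mathrm{Den}_d(\mathbb{M})\to\mathbb{R}$ be a (smooth) semi-discrete Lagrangian, let $C:\mathfrak{d}(\mathbb{M})^*\times \mathrm{Den}_d(\mathbb{M})\to\mathbb{R}$ be a (smooth) semi-discrete approximation of a Casimir, let $\theta>0$ be a constant, and let $\gamma(X,Y)=\langle hX^\flat,Y\rangle_1$ be the water-depth weighted pairing. Let $A(t)\in\mathcal{R}$ and $h(t)\in \mathrm{Den}_d(\mathbb{M})$, $t\in[0,T]$, be smooth curves, and write $\frac{\delta C}{\delta M}$ for the derivative of $C$ evaluated at $(M,h)$ with $M=\frac{\delta \ell}{\delta A}(A,h)$. Then the curves $A(t),h(t)$ are critical for the variational principle $$\Big(\delta\int_0^T \ell(A,h)\,dt\Big)+\theta\int_0^T\gamma\Big(\Big[\!\Big[\frac{\delta C}{\delta M},A\Big]\!\Big],[A,B]\Big)dt=0$$ with respect to all variations of the form $$\delta A=\partial_t B+[B,A],\qquad \delta h=-\Omega^{-1}B^{\top}\Omega h,$$ where $B(t)$ is an arbitrary smooth curve in $\mathcal{R}$ with $B(0)=B(T)=0$, if and only if for all $t\in[0,T]$, all $i$ and all $j\in N(i)$, $$P\left(\frac{d}{dt}\frac{\delta \ell}{\delta A}+\mathcal{L}_A\Big(\frac{\delta \ell}{\delta A}\Big)-\theta\,\mathcal{L}_A\Big(h\Big[\!\Big[\frac{\delta C}{\delta M},A\Big]\!\Big]^\flat\Big)+h\,\frac{\delta \ell}{\delta h}^{\top}\right)_{ij}=0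 .$$
   Context: Mesh. $\mathbb{M}$ is a two-dimensional simplicial mesh with $n$ triangular cells $T_1,\dots,T_n$ of a closed (boundaryless) two-dimensional fluid domain, together with its circumcentric dual mesh, whose cells are denoted $\zeta$ (one per node of the mesh). $N(i)$ is the set of indices $j\neq i$ such that $T_j$ shares an edge with $T_i$; $e_{ij}=T_i\cap T_j$ is the primal edge and $\tilde e_{ij}$ the corresponding dual edge; $|\cdot|$ denotes length or area. $\Omega$ is the $n\times n$ diagonal matrix whose entry $\Omega_{ii}>0$ is the area of $T_i$. Lie algebra and constraint. $\mathfrak{d}(\mathbb{M})=\{A\in\mathfrak{gl}(n,\mathbb{R}) : A\cdot\mathbf{1}=0\}$, $\mathbf{1}=(1,\dots,1)^\top$, with bracket the matrix commutator $[A,B]=AB-BA$. $\mathcal{R}\subset\mathfrak{d}(\mathbb{M})$ is the linear subspace of those $A\in\mathfrak{d}(\mathbb{M})$ such that $A^\top\Omega+\Omega A$ is diagonal and $A_{ij}=0$ whenever $j\notin N(i)\cup\{i\}$. It is treated as a nonholonomic constraint ($A$ and $B$ lie in $\mathcal{R}$, while $\delta A$ need only lie in $\mathfrak{d}(\mathbb{M})$). Pairings. For $n\times n$ matrices, $\langle L,A\rangle_1=\mathrm{Tr}(L^\top\Omega A)$. The space $\mathfrak{d}(\mathbb{M})^*$ is represented by $n\times n$ matrices via this pairing, two matrices representing the same element if they pair identically with all of $\mathfrak{d}(\mathbb{M})$. Discrete functions $\Omega^0_d(\mathbb{M})$ and discrete densities $\mathrm{Den}_d(\mathbb{M})$ are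 both $\mathbb{R}^n$, paired by $\langle F,G\rangle_0=F^\top\Omega G$. The map $P$ is defined on matrices by $P(L)_{ij}=\tfrac12(L_{ij}-L_{ji}-L_{ii}+L_{jj})$; it depends only on the class of $L$ in $\mathfrak{d}(\mathbb{M})^*$. Functional derivatives. $\frac{\delta\ell}{\delta A}\in\mathfrak{d}(\mathbb{M})^*$, $\frac{\delta\ell}{\delta h}\in\Omega_d^0(\mathbb{M})$, $\frac{\delta C}{\delta M}\in\mathfrak{d}(\mathbb{M})$ are defined by $\langle\frac{\delta\ell}{\delta A},\delta A\rangle_1=\frac{d}{d\varepsilon}|_{\varepsilon=0}\ell(A+\varepsilon\delta A,h)$, $\langle\frac{\delta\ell}{\delta h},\delta h\rangle_0=\frac{d}{d\varepsilon}|_{\varepsilon=0}\ell(A,h+\varepsilon\delta h)$, $\langle\delta M,\frac{\delta C}{\delta M}\rangle_1=\frac{d}{d\varepsilon}|_{\varepsilon=0}C(M+\varepsilon\delta M,h)$ for all $\delta A\in\mathfrak{d}(\mathbb{M})$, $\delta h\in\mathrm{Den}_d(\mathbb{M})$, $\delta M\in\mathfrak{d}(\mathbb{M})^*$. The expression $h\frac{\delta\ell}{\delta h}^\top$ is the $n\times n$ outer product of the column vectors $h$ and $\frac{\delta\ell}{\delta h}$. Discrete Lie derivative. $\mathcal{L}_AM$ is defined by $\langle\mathcal{L}_AM,B\rangle_1=\langle M,[A,B]\rangle_1$ for all $B$. Flat operator. For $X\in\mathcal{R}$, $X^\flat$ is the antisymmetric $n\times n$ matrix with $X^\flat_{ij}=2\Omega_{ii}\frac{|\tilde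 e_{ij}|}{|e_{ij}|}X_{ij}$ for $j\in N(i)$, and, for $i,k\in N(j)$, $i\neq k$, $k\notin N(i)$, determined by $X^\flat_{ij}+X^\flat_{jk}+X^\flat_{ki}=\frac{|\zeta\cap T_j|}{|\zeta|}\sum_{\tilde e_{nm}\in\partial\zeta}X^\flat_{nm}$, where $\zeta$ is the dual cell of the node common to $T_i,T_j,T_k$ and $\partial\zeta$ is oriented in the sense $i\to j\to k$; all remaining entries are $0$. The product of $h$ with a matrix $L$ is $(hL)_{ij}=h_iL_{ij}$. Discrete commutator. $[\![\cdot,\cdot]\!]$ is a fixed discrete commutator with values in $\mathcal{R}$ (a discretization of the Lie bracket of vector fields), so that $X=[\![\frac{\delta C}{\delta M},A]\!]\in\mathcal{R}$ and $X^\flat$ is defined; it is not the matrix commutator. The form $\gamma$ is $\gamma(X,Y)=\langle hX^\flat,Y\rangle_1$ for $X\in\mathcal{R}$, $Y\in\mathfrak{d}(\mathbb{M})$. *)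

(* Defs.v *)
From HB Require Import structures.
From mathcomp Require Import all_boot all_order all_algebra.
From mathcomp Require Import all_classical all_reals all_analysis.

Set Implicit Arguments.
Unset Strict Implicit.
Unset Printing Implicit Defensive.

Import Order.TTheory GRing.Theory Num.Theory.
Import numFieldNormedType.Exports.

Local Open Scope classical_set_scope.
Local Open Scope ring_scope.

(* A closed triangulated surface with [n] triangles, given as an abstract
   simplicial complex, together with the lengths and areas of its primal and
   dual cells. Dual cells are indexed by the nodes, primal and dual edges by the
   two-element vertex sets of the primal edges, so that e_ij is
   [tri i :&: tri j]. The lengths and areas are free parameters: a circumcentric
   dual, on a flat or on a curved surface, is one choice of their values, and no
   further relation between them is needed. *)
Record mesh (R : realType) (n : nat) := Mesh {
  node : finType;
  tri : 'I_n -> {set node};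
  card_tri : forall i, #|tri i| = 3%N;
  tri_inj : injective tri;
  (* no boundary: every edge belongs to exactly two triangles *)
  mesh_closed : forall (i : 'I_n) (e : {set node}),
    e \subset tri i -> #|e| = 2%N -> #|[set j | e \subset tri j]%SET| = 2%N;
  (* the triangles around a node form one cycle of edge-adjacent triangles;
     [star v] lists them in one of the two cyclic orders *)
  star : node -> seq 'I_n;
  mem_star : forall v i, (i \in star v) = (v \in tri i);
  star_nonempty : forall v, star v != [::];
  star_uniq : forall v, uniq (star v);
  star_cycle : forall v,
    cycle (fun i j => #|(tri i :&: tri j)%SET| == 2%N) (star v);
  (* |T_i| *)
  tri_area : 'I_n -> R;
  (* |e| and |~e| *)
  edge_len : {set node} -> R;
  dual_len : {set node} -> R;
  (* |zeta| and |zeta cap T_i| *)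
  dual_area : node -> R;
  cap_area : node -> 'I_n -> R;
  tri_area_gt0 : forall i, 0 < tri_area i;
  edge_len_gt0 : forall e, 0 < edge_len e;
  dual_len_ge0 : forall e, 0 <= dual_len e;
  dual_area_gt0 : forall v, 0 < dual_area v;
  cap_area_ge0 : forall v i, 0 <= cap_area v i
}.

Section Matrices.
Variables (R : realType) (n : nat) (K : mesh R n).
Implicit Types (A B X Y L : 'M[R]_n) (F G h : 'cV[R]_n).

Definition edge (i j : 'I_n) : {set node K} := (tri K i :&: tri K j)%SET.

Definition nbr (i : 'I_n) : {set 'I_n} := [set j | (j != i) && (#|edge i j| == 2%N)]%SET.

Definition Omega : 'M[R]_n := diag_mx (\row_i tri_area K i).

Definition ones : 'cV[R]_n := const_mx 1.

Definition dM : set 'M[R]_n := [set A | A *m ones = 0].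

Definition constraint : set 'M[R]_n := [set A | [/\ dM A,
  is_diag_mx (A^T *m Omega + Omega *m A) &
  forall i j, j \notin nbr i -> j != i -> A i j = 0]].

Definition comm A B : 'M[R]_n := A *m B - B *m A.

Definition pair1 L A : R := \tr (L^T *m Omega *m A).

Definition pair0 F G : R := (F^T *m Omega *m G) ord0 ord0.

(* [L] and [L'] represent the same element of the dual of [dM] *)
Definition dM_dual_eq L L' : Prop := forall A, dM A -> pair1 L A = pair1 L' A.

(* Some matrix representing the element [phi] of the dual of [dM]; it is unique
   only up to [dM_dual_eq]. *)
Definition dM_dual_repr (phi : 'M[R]_n -> R) : 'M[R]_n :=
  xget 0 [set L | forall A, dM A -> pair1 L A = phi A].

Definition Pmap L : 'M[R]_n :=
  \matrix_(i, j) (2^-1 * (L i j - L j i - L i i + L j j)).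

Definition lie_derivative A L : 'M[R]_n :=
  dM_dual_repr (fun B => pair1 L (comm A B)).

Definition hmul h L : 'M[R]_n := \matrix_(i, j) (h i ord0 * L i j).

Definition flat_edge X : 'M[R]_n := \matrix_(i, j)
  if j \in nbr i
  then 2 * Omega i i * (dual_len (edge i j) / edge_len (edge i j)) * X i j
  else 0.

(* Sum of the entries of [F] along the boundary of the dual cell of [v],
   oriented in the sense i -> j, for [i] and [j] consecutive around [v]. *)
Definition circulation (F : 'M[R]_n) (v : node K) (i j : 'I_n) : R :=
  if next (star v) i == j then \sum_(p <- star v) F p (next (star v) p)
  else \sum_(p <- star v) F p (prev (star v) p).

(* For i, k adjacent to j but not to each other, the entry (i, k) solves
     X_ij + X_jk + X_ki = |zeta cap T_j| / |zeta| * circulation (i -> j -> k)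
   (lemma [flat_node] below). The triangle j is unique unless zeta is the dual
   cell of a node of valence four; then two triangles j qualify, the two
   equations are in general incompatible, and one of them is used. *)
Definition flat X : 'M[R]_n := \matrix_(i, k)
  if (i == k) || (k \in nbr i) then flat_edge X i k
  else if [pick p : 'I_n * node K | [&& i \in nbr p.1, k \in nbr p.1,
             p.2 \in tri K i, p.2 \in tri K p.1 & p.2 \in tri K k]] is Some (j, v)
  then flat_edge X i j + flat_edge X j k
       - cap_area v j / dual_area v * circulation (flat_edge X) v i j
  else 0.

Definition gamma h X Y : R := pair1 (hmul h (flat X)) Y.

(* A discretization of the Lie bracket of vector fields: a bilinear bracket with
   values in [constraint]. Skew-symmetry is not needed, and the first argument
   ranges over all of [dM]. *)
Definition discrete_commutator (br : 'M[R]_n -> 'M[R]_n -> 'M[R]_n) : Prop :=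
  [/\ forall X Y, dM X -> constraint Y -> constraint (br X Y),
      forall a X X' Y, dM X -> dM X' -> constraint Y ->
        br (a *: X + X') Y = a *: br X Y + br X' Y &
      forall a X Y Y', dM X -> constraint Y -> constraint Y' ->
        br X (a *: Y + Y') = a *: br X Y + br X Y'].

End Matrices.

Section Smoothness.
Variable R : realType.

Fixpoint iter_derive (V : normedModType R) (f : V -> R^o) (vs : seq V) : V -> R^o :=
  if vs is v :: vs' then 'D_v (iter_derive f vs') else f.

(* [f] is C^oo on the linear subspace [W]; only the values of [f] on [W] matter. *)
Definition smooth_on (V : normedModType R) (W : set V) (f : V -> R^o) : Prop :=
  forall vs : seq V, (forall v, v \in vs -> W v) ->
    {within W, continuous (iter_derive f vs)} /\
    (forall x v, W x -> W v -> derivable (iter_derive f vs) x v).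

Definition diff_quot (V : normedModType R) (f : R -> V) (t s : R) : V :=
  (s - t)^-1 *: (f s - f t).

(* Time derivative of a curve defined on [D]; one-sided at the endpoints of an
   interval. *)
Definition ddt (D : set R) (V : normedModType R) (f : R -> V) (t : R) : V :=
  lim (diff_quot f t s @[s --> within D t^']).

Definition smooth_curve (D : set R) (V : normedModType R) (f : R -> V) : Prop :=
  forall (k : nat) (t : R), D t ->
    cvg (diff_quot (iter k (@ddt D V) f) t s @[s --> within D t^']).

End Smoothness.

Section Variational.
Variables (R : realType) (n : nat) (K : mesh R n).
Implicit Types (l C : 'M[R]_n -> 'cV[R]_n -> R).

Definition dl_dA l (A : 'M[R]_n) (h : 'cV[R]_n) : 'M[R]_n :=
  dM_dual_repr K (fun dA => derive1 (fun e : R^o => l (A + e *: dA) h : R^o) 0).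

Definition dl_dh l (A : 'M[R]_n) (h : 'cV[R]_n) : 'cV[R]_n :=
  xget 0 [set F | forall dh,
    pair0 K F dh = derive1 (fun e : R^o => l A (h + e *: dh) : R^o) 0].

Definition dC_dM C (M : 'M[R]_n) (h : 'cV[R]_n) : 'M[R]_n :=
  xget 0 [set D | @dM R n D /\ forall dL,
    pair1 K dL D = derive1 (fun e : R^o => C (M + e *: dL) h : R^o) 0].

Definition smooth_lagrangian l : Prop :=
  smooth_on [set p : 'M[R]_n * 'cV[R]_n | @dM R n p.1] (fun p => l p.1 p.2).

(* A function on (dual of [dM]) x R^n is one on matrices compatible with
   [dM_dual_eq]; smoothness on the quotient is smoothness of this lift. *)
Definition smooth_casimir C : Prop :=
  (forall L L' h, dM_dual_eq K L L' -> C L h = C L' h) /\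
  smooth_on [set: 'M[R]_n * 'cV[R]_n] (fun p => C p.1 p.2).

(* Differentiating each pairing makes the derivative independent of the matrices
   [mu s] chosen to represent the curve in the dual of [dM]. *)
Definition dM_dual_ddt (D : set R) (mu : R -> 'M[R]_n) (t : R) : 'M[R]_n :=
  dM_dual_repr K (fun A => ddt D (fun s => pair1 K (mu s) A : R^o) t).

Definition first_variation l (T : R) (A : R -> 'M[R]_n) (h : R -> 'cV[R]_n)
    (dA : R -> 'M[R]_n) (dh : R -> 'cV[R]_n) : R :=
  derive1 (fun e : R^o =>
    (\int[lebesgue_measure]_(t in `[0, T]) l (A t + e *: dA t) (h t + e *: dh t)) : R^o) 0.

End Variational.

Section FlatFacts.
Variables (R : realType) (n : nat) (K : mesh R n).

Lemma edgeC i j : edge K i j = edge K j i.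
Proof. exact: finset.setIC. Qed.

Lemma in_nbr i j : (j \in nbr K i) = (j != i) && (#|edge K i j| == 2%N).
Proof. by rewrite inE. Qed.

Lemma nbrC i j : (i \in nbr K j) = (j \in nbr K i).
Proof. by rewrite !in_nbr eq_sym edgeC. Qed.

Lemma flat_edgeE X i j : j \in nbr K i ->
  flat K X i j = 2 * Omega K i i *
    (dual_len (edge K i j) / edge_len (edge K i j)) * X i j.
Proof. by move=> ij; rewrite !mxE ij orbT. Qed.

Lemma constraint_skew X i j : constraint K X -> i != j ->
  Omega K i i * X i j = - (Omega K j j * X j i).
Proof.
case=> _ /is_diag_mxP/(_ i j) + _ ij => /(_ ij).
rewrite mxE /Omega mul_diag_mx mul_mx_diag !mxE !eqxx !mulr1n => /eqP.
by rewrite addrC addr_eq0 mulrC [X j i * _]mulrC => /eqP; rewrite ![tri_area _ _ * _]mulrC.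
Qed.

Lemma flat_edge_skew X i j : constraint K X ->
  flat_edge K X i j = - flat_edge K X j i.
Proof.
move=> RX; rewrite [LHS]mxE [X in _ = - X]mxE nbrC.
case: ifP => [|_]; last by rewrite oppr0.
rewrite in_nbr => /andP[ij _]; rewrite (edgeC j i).
rewrite mulrAC [in RHS]mulrAC -[2 * _ * X i j]mulrA -[2 * _ * X j i]mulrA.
by rewrite (constraint_skew RX) ?mulrN ?mulNr // eq_sym.
Qed.

Lemma star_next v i : i \in star (m := K) v -> next (star v) i \in nbr K i.
Proof.
move=> iv; have := next_cycle (star_cycle v) iv; rewrite in_nbr => E2.
rewrite E2 andbT; apply/eqP => E; move: E2.
by rewrite E finset.setIid card_tri.
Qed.

Lemma star_prev v i : i \in star (m := K) v -> prev (star v) i \in nbr K i.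
Proof.
rewrite -mem_prev => /star_next.
by rewrite next_prev ?star_uniq // nbrC.
Qed.

Lemma nbr_edge_eq i j k : i \in nbr K j -> k \in nbr K j ->
  edge K j i = edge K j k -> i = k.
Proof.
rewrite !in_nbr => /andP[ij /eqP ci] /andP[kj _] e.
have /eqP := mesh_closed (finset.subsetIl (tri K j) (tri K i)) ci.
apply: contraTeq => ik; rewrite gtn_eqF //.
have <- : #|[set j; i; k]%SET| = 3%N.
  by rewrite -finset.setUA !cardsU1 !inE cards1 negb_or eq_sym ij eq_sym kj ik.
apply/subset_leq_card/fintype.subsetP => p.
rewrite !inE -orbA => /or3P[]/eqP->; rewrite ?finset.subsetIl ?finset.subsetIr //.
by move: e; rewrite /edge => ->; rewrite finset.subsetIr.
Qed.

Lemma star_nbr v i j : i \in nbr K j -> v \in tri K i -> v \in tri K j ->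
  i = next (star v) j \/ i = prev (star v) j.
Proof.
move=> ij iv jv.
have sub k : k \in nbr K j -> v \in tri K k -> exists x, edge K j k = [set v; x]%SET /\
    x \in (tri K j :\ v)%SET.
  move=> kj kv; move: (kj); rewrite in_nbr => /andP[_ c2].
  have vE : v \in edge K j k by rewrite inE jv.
  move: c2; rewrite (cardsD1 v) vE eqSS => /cards1P[x E].
  exists x; split; first by rewrite -E finset.setD1K.
  have : x \in (edge K j k :\ v)%SET by rewrite E inE.
  by rewrite !inE => /and3P[-> ->].
have js : j \in star v by rewrite mem_star.
have is_ : i \in star v by rewrite mem_star.
have [->|ni] := eqVneq i (next (star v) j); first by left.
have [->|np] := eqVneq i (prev (star v) j); first by right.
exfalso.
have nsp : next (star v) j != prev (star v) j.
  have [r s E] := rot_to js; move: (star_uniq v) is_ ni np.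
  rewrite -(rot_uniq r) -(mem_rot r) -(next_rot r) ?star_uniq //.
  rewrite -(prev_rot r) ?star_uniq // E.
  move: ij; rewrite in_nbr => /andP[/negPf ij _].
  case: s E => [|a [|b s]] E.
  - by rewrite inE ij.
  - by rewrite !inE ij /= eqxx => _ ->.
  have prevE y t : j \notin t -> prev_at j j y t = last y t.
    elim: t y => [|c t IH] y /=; first by rewrite eqxx.
    rewrite inE negb_or eq_sym => /andP[/negPf-> /IH].
    exact.
  move=> /andP[/prevE jE] + _ _ _.
  rewrite [prev _ _]jE [next _ _]/= eqxx /= => /andP[+ _].
  by apply: contraNneq => {1}->; rewrite mem_last.
have vn k : k \in star v -> v \in tri K k by rewrite mem_star.
have [x [Ex xj]] := sub _ ij iv.
have [y [Ey yj]] := sub _ (star_next js) (vn _ (etrans (mem_next _ _) js)).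
have [z [Ez zj]] := sub _ (star_prev js) (vn _ (etrans (mem_prev _ _) js)).
have [xy|nxy] := eqVneq x y.
  by move/eqP: ni; apply; apply: (nbr_edge_eq ij (star_next js)); rewrite Ex Ey xy.
have [xz|nxz] := eqVneq x z.
  by move/eqP: np; apply; apply: (nbr_edge_eq ij (star_prev js)); rewrite Ex Ez xz.
have [yz|nyz] := eqVneq y z.
  by move/eqP: nsp; apply; apply: (nbr_edge_eq (star_next js) (star_prev js)); rewrite Ey Ez yz.
have : (#|[set x; y; z]%SET| <= #|(tri K j :\ v)%SET|)%N.
  by apply/subset_leq_card/fintype.subsetP => p; rewrite !inE -orbA => /or3P[]/eqP->;
     rewrite -finset.in_setD1.
have := cardsD1 v (tri K j); rewrite card_tri jv add1n => -[<-].
by rewrite -finset.setUA !cardsU1 !inE cards1 negb_or nxy nxz nyz.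
Qed.

Lemma circulationC (F : 'M[R]_n) v i j k : (forall p q, F p q = - F q p) ->
  i \in nbr K j -> k \in nbr K j -> i != k ->
  v \in tri K i -> v \in tri K j -> v \in tri K k ->
  circulation F v k j = - circulation F v i j.
Proof.
move=> Fskew ij kj ik iv jv kv.
have U := star_uniq v.
have rev : \sum_(p <- star v) F p (prev (star v) p) =
           - \sum_(p <- star v) F p (next (star v) p).
  rewrite -sumrN.
  have -> : \sum_(p <- star v) F p (prev (star v) p) =
      \sum_(p <- star v) F (next (star v) p) p.
    have P : perm_eq (star v) (map (next (star v)) (star v)).
      apply: uniq_perm => //.
        by rewrite map_inj_uniq //; apply: can_inj (prev_next U).
      move=> p; apply/idP/mapP => [ps|[q qs ->]]; last by rewrite mem_next.
      by exists (prev (star v) p); rewrite ?mem_prev ?next_prev.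
    rewrite (perm_big _ P) big_map.
    by apply: eq_bigr => p _; rewrite (prev_next U).
  by apply: eq_bigr => p _; rewrite Fskew.
have Ni : next (star v) i = j <-> i = prev (star v) j.
  by split=> [<-|->]; rewrite ?(prev_next U) ?(next_prev U).
have Nk : next (star v) k = j <-> k = prev (star v) j.
  by split=> [<-|->]; rewrite ?(prev_next U) ?(next_prev U).
rewrite /circulation; case: eqP => [/Nk Ek|nk]; case: eqP => [/Ni Ei|ni'].
- by move: ik; rewrite Ei Ek eqxx.
- by rewrite rev opprK.
- by rewrite rev.
case: (star_nbr ij iv jv) => Ei; last by case: ni'; apply/Ni.
case: (star_nbr kj kv jv) => Ek; last by case: nk; apply/Nk.
by move: ik; rewrite Ei Ek eqxx.
Qed.

Lemma flat_skew X i k : constraint K X -> flat K X i k = - flat K X k i.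
Proof.
move=> RX; rewrite [LHS]mxE [X in _ = - X]mxE (nbrC k i) (eq_sym k).
case: ifP => [_|/norP[ik _]]; first exact: flat_edge_skew.
rewrite (@eq_pick _ _ (fun p => [&& k \in nbr K p.1, i \in nbr K p.1,
    p.2 \in tri K k, p.2 \in tri K p.1 & p.2 \in tri K i])); last first.
  by move=> p /=; do 5!case: (_ \in _).
case: pickP => [[j v] /= /and5P[kj ij kv jv iv]|_]; last by rewrite oppr0.
rewrite (circulationC (fun p q => flat_edge_skew p q RX) ij kj ik iv jv kv).
rewrite (flat_edge_skew i j RX) (flat_edge_skew j k RX).
by rewrite mulrN !opprD !opprK [- _ - _]addrC.
Qed.

(* The defining relation of [flat]; [j'] ranges over the candidates for the
   triangle adjacent to both [i] and [k]. *)
Lemma flat_node X i j k v : constraint K X ->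
  i \in nbr K j -> k \in nbr K j -> i != k -> k \notin nbr K i ->
  v \in tri K i -> v \in tri K j -> v \in tri K k ->
  (forall j', i \in nbr K j' -> k \in nbr K j' -> j' = j) ->
  flat K X i j + flat K X j k + flat K X k i =
    cap_area v j / dual_area v * circulation (flat K X) v i j.
Proof.
move=> RX ij kj ik ki iv jv kv uj.
have -> : circulation (flat K X) v i j = circulation (flat_edge K X) v i j.
  rewrite /circulation; case: ifP => _; apply: eq_big_seq => p /[dup] ps.
    by move/star_next; rewrite mxE => ->; rewrite orbT.
  by move/star_prev; rewrite mxE => ->; rewrite orbT.
rewrite (flat_skew k i RX).
rewrite [flat K X i j]mxE -(nbrC i j) ij orbT [flat K X j k]mxE kj orbT.
rewrite [flat K X i k]mxE (negPf ik) (negPf ki) /=.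
case: pickP => [[j' v'] /= /and5P[ij' kj' iv' jv' kv']|/(_ (j, v))]; last first.
  by rewrite /= ij kj iv jv kv.
have -> : v' = v.
  apply/eqP; apply: contraNT ki => v'v; rewrite in_nbr (eq_sym k) ik /=.
  rewrite eqn_leq; apply/andP; split.
    rewrite -ltnS -(card_tri K i) ltn_neqAle subset_leq_card ?finset.subsetIl //.
    rewrite andbT; apply: contraNneq ik => c3; apply/eqP/(@tri_inj _ _ K).
    have /eqP E : edge K i k == tri K i by rewrite eqEcard finset.subsetIl c3 leqnn.
    have sik : tri K i \subset tri K k by rewrite -E finset.subsetIr.
    by apply/eqP; rewrite eqEcard sik !card_tri.
  have <- : #|[set v'; v]%SET| = 2%N by rewrite cards2 v'v.
  by apply/subset_leq_card/fintype.subsetP => p; rewrite !inE => /orP[]/eqP->;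
     apply/andP.
by rewrite (uj j') // opprB addrC subrK.
Qed.

Lemma flat_far X i k : i != k -> k \notin nbr K i ->
  (forall j, i \in nbr K j -> k \notin nbr K j) -> flat K X i k = 0.
Proof.
move=> ik ki far; rewrite mxE (negPf ik) (negPf ki) /=.
case: pickP => [[j v] /= /and5P[ij kj _ _ _]|//].
by have := far _ ij; rewrite kj.
Qed.

End FlatFacts.

(* Main.v *)
Require Import Defs.
From HB Require Import structures.
From mathcomp Require Import all_boot all_order all_algebra.
From mathcomp Require Import all_classical all_reals all_analysis.
From mathcomp Require Import ring lra.

Set Implicit Arguments.
Unset Strict Implicit.
Unset Printing Implicit Defensive.

Import Order.TTheory GRing.Theory Num.Theory.
Import numFieldNormedType.Exports.

Local Open Scope classical_set_scope.
Local Open Scope ring_scope.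

(** Critical curves of the action are found as in the continuous theory, the
    point being that every object is finite dimensional.

    Let [Z t] be the matrix in the argument of [Pmap]. For a variation generated
    by a curve [B] in [constraint], the integrand of the variational principle is

      d/dt <M, B> - <Z, B>

    ([pair1_ZE]): the terms that contain the time derivative of [B] form the
    total derivative, the bracket terms become Lie derivatives by the definition
    of [lie_derivative], and the variation of [h] becomes the outer product of
    [h] with dl/dh. The total derivative integrates to zero because [B] vanishes
    at both ends, so the principle says that the integral of <Z, B> vanishes for
    all such [B] ([variation_integral]).

    Testing with [B t = q.[t] *: E], for a polynomial [q] that vanishes at 0 and
    T and a fixed [E] in [constraint], the fundamental lemma of the calculus of
    variations ([poly_test_eq0]) gives <Z t, E> = 0 at every time.
    Finally [constraint] is spanned by the elementary exchanges between two
    adjacent cells [i] and [j], and the pairing of [Z] with such an exchange is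
    [2 * Pmap Z i j] ([pair1_constraint0]); this turns the condition on all [E]
    into the condition on all pairs of neighbours.

    The analysis behind this rests on four facts. A function with continuous
    directional derivatives is strictly differentiable, whence linearity of the
    derivative in the direction and the chain rule along curves with one-sided
    derivatives ([C1_cvg_quot], [C1_chain]). A Lagrangian smooth on [dM] only is
    made smooth everywhere by composition with a linear projection
    ([smooth_ext_lagrangian]). The functional derivatives, which are chosen among
    the representatives of a linear form, exist and are determined on [dM]
    ([pair1_dl_dA], [pair0_dl_dh], [dC_dMP]). The pairings with the momentum
    depend continuously on time even where its chosen representative does not, and
    so does the bracket term ([cont_pair1_M], [cont_dC], [cont_X]); hence all
    integrands are integrable, and the action may be differentiated under the
    integral sign ([derive1_integral]). *)

(** * Functions with continuous directional derivatives *)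

Lemma cvg_sumr {R : realType} {V : normedModType R} (S I : Type)
    (F : set_system S) {FF : Filter F} (r : seq I) (f : I -> S -> V) (l : I -> V) :
  (forall i, f i @ F --> l i) ->
  \sum_(i <- r) f i s @[s --> F] --> \sum_(i <- r) l i.
Proof.
by move=> fl; apply: cvg_big => [|i _]; [exact: add_continuous|exact: fl].
Qed.

Section C1.
Context {R : realType} {V : normedModType R}.
Implicit Types (g : V -> R^o) (x y v w : V).

Definition C1 g : Prop :=
  (forall x v, derivable g x v) /\ (forall v, continuous ('D_v g)).

Lemma is_derive_line g x v (s : R) : derivable g (x + s *: v) v ->
  is_derive s (1 : R^o) (fun u : R^o => g (x + u *: v)) ('D_v g (x + s *: v)).
Proof.
move=> dg.
have E : (fun k : R => k^-1 *: (((fun u : R^o => g (x + u *: v)) \o shift s) (k *: (1 : R^o))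
             - g (x + s *: v))) =
         (fun k => k^-1 *: ((g \o shift (x + s *: v)) (k *: v) - g (x + s *: v))).
  apply/funext => k /=; congr (_ *: (g _ - _)).
  by rewrite scalerDl addrCA [k *: 1]mulr1.
by apply: DeriveDef; [rewrite /derivable E|rewrite /derive E].
Qed.

Lemma mvt_line g x v (u : R) : (forall y, derivable g y v) ->
  exists2 s : R, `|s| <= `|u| & g (x + u *: v) - g x = u * 'D_v g (x + s *: v).
Proof.
move=> dg.
pose f (s : R) := g (x + s *: v).
have df s : is_derive s (1 : R^o) (f : R^o -> R^o) ('D_v g (x + s *: v)).
  exact: is_derive_line.
have cf (a b : R) : {within `[a, b], continuous f}.
  apply: derivable_within_continuous => s _; exact: ex_derive.
have f0 : f 0 = g x by rewrite /f scale0r addr0.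
have [u0|u0] := lerP 0 u.
  have [s] := @MVT_segment R f (fun s => 'D_v g (x + s *: v)) 0 u u0
    (fun s _ => df s) (cf _ _).
  rewrite in_itv /= => /andP[s0 su]; rewrite f0 subr0 mulrC => fE.
  by exists s => //; rewrite !ger0_norm.
have [s] := @MVT_segment R f (fun s => 'D_v g (x + s *: v)) u 0 (ltW u0)
  (fun s _ => df s) (cf _ _).
rewrite in_itv /= => /andP[us s0]; rewrite f0 sub0r => fE.
exists s; first by rewrite !ler0_norm ?lerN2 // ltW.
by rewrite -[LHS]opprB fE mulrN opprK mulrC.
Qed.

(** By the mean value theorem. The estimate is uniform in the base point [y],
    which the passage to several directions requires. *)
Lemma C1_line_increment g w x (e : R) : C1 g -> 0 < e ->
  exists2 d : R, 0 < d & forall y (u : R), `|y - x| < d -> `|u| < d ->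
    `|g (y + u *: w) - g y - u * 'D_w g x| <= e * `|u|.
Proof.
move=> [dg cg] e0.
have /cvgrPdist_le/(_ _ e0)/nbhs_normP[r /= r0 Hr] := cg w x.
have w1 : 0 < 1 + `|w| by rewrite ltr_pwDl.
exists (r / (1 + `|w|)); first by rewrite divr_gt0.
move=> y u yx ud.
have [s su ->] := mvt_line y u (fun y => dg y w).
rewrite -mulrBr normrM mulrC ler_wpM2r //.
rewrite distrC Hr //= opprD addrA.
rewrite (le_lt_trans (ler_normB _ _)) // distrC normrZ.
rewrite -[ltRHS](divfK (lt0r_neq0 w1)) mulrDr mulr1 ltr_leD //.
by rewrite ler_wpM2r // (le_trans su) // ltW.
Qed.

(** Move along the directions one after the other: all intermediate points stay
    close to [x], so that the estimate for one direction applies at each. *)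
Lemma C1_increment (I : Type) (r : seq I) (w : I -> V) g x (e : R) :
  C1 g -> 0 < e ->
  exists2 d : R, 0 < d & forall y (u : I -> R), `|y - x| < d ->
    (forall i, `|u i| < d) ->
    `|g (y + \sum_(i <- r) u i *: w i) - g y - \sum_(i <- r) u i * 'D_(w i) g x|
      <= e * \sum_(i <- r) `|u i|.
Proof.
move=> Cg e0; elim: r => [|i r [d d0 IH]].
  by exists 1 => // y u _ _; rewrite !big_nil addr0 !subrr normr0 mulr0.
have [d' d'0 Hd'] := C1_line_increment (w i) x Cg e0.
have w1 : 0 < 1 + `|w i| by rewrite ltr_pwDl.
(* After the step along [w i] the base point must still be within [d] of [x]. *)
exists (Num.min d' (d / (1 + `|w i|))); first by rewrite lt_min d'0 divr_gt0.
move=> y u; rewrite lt_min => /andP[yd' yd] ud.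
have ud1 j : `|u j| < d / (1 + `|w i|) by have := ud j; rewrite lt_min => /andP[].
have ud2 j : `|u j| < d' by have := ud j; rewrite lt_min => /andP[].
have udd j : `|u j| < d.
  by rewrite (lt_le_trans (ud1 j)) // ler_pdivrMr // ler_peMr ?(ltW d0) // lerDl.
have yd2 : `|y + u i *: w i - x| < d.
  rewrite addrAC (le_lt_trans (ler_normD _ _)) // normrZ.
  rewrite -[ltRHS](divfK (lt0r_neq0 w1)) mulrDr mulr1 ltr_leD //.
  by rewrite ler_wpM2r // ltW.
have := Hd' y (u i) yd' (ud2 i); have := IH _ u yd2 udd.
rewrite !big_cons addrA => H1 H2.
rewrite mulrDr (le_trans _ (lerD H2 H1)) //.
rewrite (le_trans _ (ler_normD _ _)) //.
by rewrite le_eqVlt; apply/orP; left; apply/eqP; congr (`| _ |); ring.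
Qed.

(** The chain rule along an arbitrary filter: the increment of the argument is
    [a s *: \sum_i k i s *: w i], so that [a] plays the role of a time step and
    the [k i] are the coordinates of a difference quotient. *)
Lemma C1_cvg_quot (S : Type) (F : set_system S) {FF : Filter F}
    (I : finType) (w : I -> V) g x (a : S -> R) (k : I -> S -> R) (c : I -> R) :
  C1 g -> a @ F --> (0 : R) -> (\forall s \near F, a s != 0) ->
  (forall i, k i @ F --> c i) ->
  (a s)^-1 * (g (x + \sum_i (a s * k i s) *: w i) - g x) @[s --> F]
    --> \sum_i c i * 'D_(w i) g x.
Proof.
move=> Cg a0 an0 kc.
have sumk (h : I -> R) : \sum_i k i s * h i @[s --> F] --> \sum_i c i * h i.
  apply: cvg_sumr => i; apply: cvgM (kc i) _; exact: cvg_cst.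
have sumnk : \sum_i `|k i s| @[s --> F] --> \sum_i `|c i|.
  apply: cvg_sumr => i; exact: cvg_norm.
set B := 1 + \sum_i `|c i|.
have B0 : 0 < B by rewrite ltr_pwDl // sumr_ge0.
apply/cvgrPdist_le => e e0.
have e2 : 0 < e / 2 by rewrite divr_gt0.
have [d d0 Hd] := C1_increment (index_enum I) w x Cg (divr_gt0 e2 B0).
have small i : \forall s \near F, `|a s * k i s| < d.
  have : a s * k i s @[s --> F] --> (0 : R).
    by rewrite -[X in _ --> X](mul0r (c i)); exact: cvgM.
  by move=> /cvgr0_norm_lt; exact.
near=> s.
have as0 : a s != 0 by near: s.
have H1 : `|\sum_i c i * 'D_(w i) g x - \sum_i k i s * 'D_(w i) g x| <= e / 2.
  by near: s; move/cvgrPdist_le : (sumk (fun i => 'D_(w i) g x)); exact.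
have H2 : \sum_i `|k i s| <= B.
  near: s; apply: cvgr_le sumnk _ _; first by rewrite ltrDr.
have H3 i : `|a s * k i s| < d.
  by move: i; near: s; apply: filter_forall.
have := Hd x (fun i => a s * k i s); rewrite subrr normr0 => /(_ d0 H3) H4.
have H5 : `|(a s)^-1 * (g (x + \sum_i (a s * k i s) *: w i) - g x)
            - \sum_i k i s * 'D_(w i) g x| <= e / 2.
  have -> : \sum_i k i s * 'D_(w i) g x =
      (a s)^-1 * \sum_i (a s * k i s) * 'D_(w i) g x.
    by rewrite mulr_sumr; apply: eq_bigr => i _; rewrite mulrA mulKf.
  rewrite -mulrBr normrM normfV mulrC ler_pdivrMr ?normr_gt0 //.
  rewrite (le_trans H4) //.
  under eq_bigr do rewrite normrM.
  rewrite -mulr_sumr mulrCA mulrC ler_wpM2r //.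
  by rewrite mulrAC ler_pdivrMr // ler_wpM2l // ltW.
rewrite [e]splitr; rewrite distrC in H5.
by rewrite (le_trans _ (lerD H1 H5)) // (le_trans _ (ler_normD _ _)) // addrA subrK.
Unshelve. all: by end_near. Qed.

(** For a constant direction the difference quotients are those of the
    directional derivative itself, which is therefore linear in the direction. *)
Lemma C1_derive_sum (I : finType) (w : I -> V) (c : I -> R) g x : C1 g ->
  'D_(\sum_i c i *: w i) g x = \sum_i c i * 'D_(w i) g x.
Proof.
move=> Cg; apply/cvg_lim; first exact: norm_hausdorff.
have a0 : h @[h --> (0 : R)^'] --> (0 : R) by exact: nbhs_dnbhs.
have an0 : \forall h \near (0 : R)^', h != 0 by exact: nbhs_dnbhs_neq.
have := @C1_cvg_quot _ _ _ _ w g x _ (fun i _ => c i) c Cg a0 an0 (fun i => cvg_cst (c i)).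
move=> /(_ _ _); apply: cvg_trans; apply: near_eq_cvg; apply: nearW => h /=.
rewrite [_ + x]addrC scaler_sumr; congr (_ * (g (_ + _) - _)).
by apply: eq_bigr => i _; rewrite scalerA.
Qed.

Lemma C1_deriveD g x v v' : C1 g -> 'D_(v + v') g x = 'D_v g x + 'D_v' g x.
Proof.
move=> Cg; have := @C1_derive_sum _ (fun b : bool => if b then v else v') (fun=> 1) _ x Cg.
by rewrite !big_bool !scale1r !mul1r.
Qed.

Lemma C1_deriveZ g x (a : R) v : C1 g -> 'D_(a *: v) g x = a * 'D_v g x.
Proof.
move=> Cg; have := @C1_derive_sum _ (fun _ : 'I_1 => v) (fun=> a) _ x Cg.
by rewrite !big_ord1.
Qed.

End C1.

(** * One-sided derivatives of curves *)

Section WithinDerivative.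
Context {R : realType}.
Implicit Types (D : set R) (V W : normedModType R).

(** [ddt] as a relation: it can be computed by rules that produce existence and
    value together. *)
Definition has_ddt D V (f : R -> V) (t : R) (l : V) : Prop :=
  diff_quot f t s @[s --> within D t^'] --> l.

Lemma has_ddtP D V (f : R -> V) t :
  cvg (diff_quot f t s @[s --> within D t^']) -> has_ddt D f t (ddt D f t).
Proof. by []. Qed.

Lemma has_ddt_unique D V (f : R -> V) t l : ProperFilter (within D t^') ->
  has_ddt D f t l -> ddt D f t = l.
Proof. by move=> PF fl; apply: cvg_lim fl; exact: norm_hausdorff. Qed.

Lemma eq_has_ddt D V (f g : R -> V) t l : D t -> (forall s, D s -> f s = g s) ->
  has_ddt D f t l -> has_ddt D g t l.
Proof.
move=> Dt fg; apply: cvg_trans; apply: near_eq_cvg.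
rewrite near_withinE; near=> s => Ds.
by rewrite /diff_quot !fg.
Unshelve. all: by end_near. Qed.

Lemma diff_quotK V (f : R -> V) t s : f s = f t + (s - t) *: diff_quot f t s.
Proof.
rewrite /diff_quot; have [->|st] := eqVneq s t.
  by rewrite subrr scale0r addr0.
by rewrite scalerA divff ?scale1r ?subr_eq0 // addrC subrK.
Qed.

Lemma cvg_step D (t : R) : (s - t) @[s --> within D t^'] --> (0 : R).
Proof.
apply: cvg_within_filter.
have : (s - t) @[s --> t] --> t - t by apply: cvgB; [exact: cvg_id|exact: cvg_cst].
by rewrite subrr => /cvg_within_filter; exact.
Qed.

Lemma near_step_neq0 D (t : R) : \forall s \near within D t^', s - t != 0.
Proof.
rewrite near_withinE; near=> s => _; rewrite subr_eq0; near: s.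
exact: nbhs_dnbhs_neq.
Unshelve. all: by end_near. Qed.

Lemma has_ddt_cvg D V (f : R -> V) t l : has_ddt D f t l ->
  f s @[s --> within D (nbhs t)] --> f t.
Proof.
move=> fl.
have /cvgrPdist_lt H : f s @[s --> within D t^'] --> f t.
  under eq_fun do rewrite (diff_quotK f t).
  have : f t + (s - t) *: diff_quot f t s @[s --> within D t^'] --> f t + 0 *: l.
    by apply: cvgD; [exact: cvg_cst|apply: cvgZ => //; exact: cvg_step].
  by rewrite scale0r addr0.
apply/cvgrPdist_lt => e e0; have := H _ e0.
rewrite !near_withinE; apply: filterS => s Hs Ds.
by have [->|st] := eqVneq s t; [rewrite subrr normr0|exact: Hs].
Qed.

Lemma has_ddtM D (f g : R -> R^o) t f' g' : has_ddt D f t f' -> has_ddt D g t g' ->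
  has_ddt D (fun s => f s * g s : R^o) t (f' * g t + f t * g').
Proof.
move=> ff gg; rewrite /has_ddt.
have -> : diff_quot (fun s => f s * g s : R^o) t =
    (fun s => diff_quot f t s * g t + f t * diff_quot g t s +
       (s - t) * (diff_quot f t s * diff_quot g t s)).
  apply/funext => s; rewrite {1}/diff_quot.
  rewrite (diff_quotK f t s) (diff_quotK g t s).
  have [->|st] := eqVneq s t.
    by rewrite /diff_quot subrr !invr0 !scale0r !(mul0r, mulr0, addr0).
  rewrite /GRing.scale /=; field; by rewrite subr_eq0.
have <- : f' * g t + f t * g' + 0 * (f' * g') = f' * g t + f t * g'.
  by rewrite mul0r addr0.
apply: cvgD; first by apply: cvgD; apply: cvgM => //; exact: cvg_cst.
by apply: cvgM; [exact: cvg_step|exact: cvgM].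
Qed.

Lemma has_ddt_lincomb D (a : R) (f g : R -> R^o) t f' g' :
  has_ddt D f t f' -> has_ddt D g t g' ->
  has_ddt D (fun s => a * f s + g s : R^o) t (a * f' + g').
Proof.
move=> ff gg; rewrite /has_ddt.
have -> : diff_quot (fun s => a * f s + g s : R^o) t =
    (fun s => a * diff_quot f t s + diff_quot g t s).
  apply/funext => s; rewrite /diff_quot.
  by have scE (u v : R) : u *: (v : R^o) = u * v by []; rewrite !scE; ring.
by apply: cvgD => //; apply: cvgM => //; exact: cvg_cst.
Qed.

Lemma has_ddtZ D V (f : R -> R^o) (v : V) t f' : has_ddt D f t f' ->
  has_ddt D (fun s => f s *: v) t (f' *: v).
Proof.
move=> ff; rewrite /has_ddt.
have -> : diff_quot (fun s => f s *: v) t = (fun s => diff_quot f t s *: v).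
  by apply/funext => s; rewrite /diff_quot -scalerBl scalerA.
by apply: cvgZr_tmp.
Qed.

Lemma has_ddt_sum D V (I : Type) (r : seq I) (f : I -> R -> V) t (f' : I -> V) :
  (forall i, has_ddt D (f i) t (f' i)) ->
  has_ddt D (fun s => \sum_(i <- r) f i s) t (\sum_(i <- r) f' i).
Proof.
move=> ff; rewrite /has_ddt.
have -> : diff_quot (fun s => \sum_(i <- r) f i s) t =
    (fun s => \sum_(i <- r) diff_quot (f i) t s).
  by apply/funext => s; rewrite /diff_quot -sumrB scaler_sumr.
exact: cvg_sumr.
Qed.

Lemma has_ddt_pair D V W (f : R -> V) (g : R -> W) t f' g' :
  has_ddt D f t f' -> has_ddt D g t g' ->
  has_ddt D (fun s => (f s, g s)) t (f', g').
Proof. exact: cvg_pair. Qed.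

(** No point of the interval is isolated in it, the endpoints included, so limits
    of difference quotients are unique. *)
Lemma proper_within_itv (a b t : R) : a < b -> t \in `[a, b] ->
  ProperFilter (within (`[a, b] : set R) t^').
Proof.
move=> ab; rewrite in_itv /= => /andP[at_ tb].
apply: Build_ProperFilter_ex => P /nbhs_ballP[e /= e0 He].
have [tlb|btl] := ltrP t b.
  have m0 : 0 < Num.min e (b - t) / 2 by rewrite divr_gt0 // lt_min e0 subr_gt0.
  have m1 : Num.min e (b - t) <= e by rewrite ge_min lexx.
  have m2 : Num.min e (b - t) <= b - t by rewrite ge_min lexx orbT.
  exists (t + Num.min e (b - t) / 2); apply: He => /=.
  - by rewrite /ball /= opprD addNKr normrN ger0_norm //; lra.
  - by rewrite -subr_eq0 addrAC subrr add0r gt_eqF.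
  - by rewrite in_itv /=; apply/andP; split; lra.
have m0 : 0 < Num.min e (b - a) / 2 by rewrite divr_gt0 // lt_min e0 subr_gt0.
have m1 : Num.min e (b - a) <= e by rewrite ge_min lexx.
have m2 : Num.min e (b - a) <= b - a by rewrite ge_min lexx orbT.
exists (t - Num.min e (b - a) / 2); apply: He => /=.
- by rewrite /ball /= opprB addrCA subrr addr0 ger0_norm //; lra.
- by rewrite -subr_eq0 addrAC subrr add0r oppr_eq0 gt_eqF.
- by rewrite in_itv /=; apply/andP; split; lra.
Qed.

End WithinDerivative.

(** * Coordinates on matrices times vectors *)

Section Coordinates.
Context {R : realType} {n : nat}.
Local Notation V := ('M[R]_n * 'cV[R]_n)%type.
Implicit Types (g : V -> R^o).

Definition basisV (i : 'I_n * 'I_n + 'I_n) : V :=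
  match i with
  | inl ij => (delta_mx ij.1 ij.2, 0)
  | inr k => (0, delta_mx k ord0)
  end.

Definition coordV (i : 'I_n * 'I_n + 'I_n) (v : V) : R :=
  match i with
  | inl ij => v.1 ij.1 ij.2
  | inr k => v.2 k ord0
  end.

Lemma sum_coordV (v : V) : v = \sum_i coordV i v *: basisV i.
Proof.
rewrite big_sumType /=; case: v => [X k] /=.
have fstE (I : finType) (F : I -> V) : (\sum_i F i).1 = \sum_i (F i).1.
  by apply: (big_morph fst).
have sndE (I : finType) (F : I -> V) : (\sum_i F i).2 = \sum_i (F i).2.
  by apply: (big_morph snd).
rewrite [RHS]surjective_pairing /= !fstE !sndE /=.
under [X in (_ + X, _)]eq_bigr do rewrite scaler0.
under [X in (_, X + _)]eq_bigr do rewrite scaler0.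
rewrite !big1_eq addr0 add0r; congr (_, _).
  by rewrite {1}[X]matrix_sum_delta pair_bigA.
rewrite {1}[k]matrix_sum_delta; apply: eq_bigr => i _.
by rewrite big_ord1.
Qed.

Lemma cvg_coordV (S : Type) (F : set_system S) {FF : Filter F} (v : S -> V) v0 i :
  v @ F --> v0 -> coordV i (v s) @[s --> F] --> coordV i v0.
Proof.
move=> vF; case: i => [ij|k] /=.
  apply: (continuous_cvg _ (@coord_continuous _ _ _ ij.1 ij.2 v0.1)).
  by apply: continuous_cvg vF; exact: cvg_fst.
apply: (continuous_cvg _ (@coord_continuous _ _ _ k ord0 v0.2)).
by apply: continuous_cvg vF; exact: cvg_snd.
Qed.

Lemma C1_deriveE g x v : C1 g ->
  'D_v g x = \sum_i coordV i v * 'D_(basisV i) g x.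
Proof. by move=> Cg; rewrite {1}[v]sum_coordV C1_derive_sum. Qed.

(** Joint continuity in the point and the direction: in coordinates the direction
    enters linearly, through finitely many fixed directions. *)
Lemma cvg_C1_derive (S : Type) (F : set_system S) {FF : Filter F} g
    (p v : S -> V) p0 v0 : C1 g ->
  p @ F --> p0 -> v @ F --> v0 -> 'D_(v s) g (p s) @[s --> F] --> 'D_v0 g p0.
Proof.
move=> Cg pF vF; under eq_fun do rewrite (C1_deriveE _ _ Cg).
rewrite (C1_deriveE _ _ Cg).
apply: cvg_sumr => i.
apply: cvgM; first exact: cvg_coordV.
exact: (continuous_cvg _ (Cg.2 (basisV i) p0) pF).
Qed.

(** [D] is arbitrary, so this covers one-sided derivatives as well: the difference
    quotient of [p] is expanded in coordinates and [s - t] is the step. *)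
Lemma C1_chain (D : set R) g (p : R -> V) t p' : C1 g ->
  has_ddt D p t p' -> has_ddt D (g \o p : R -> R^o) t ('D_p' g (p t)).
Proof.
move=> Cg pp; rewrite (C1_deriveE _ _ Cg) /has_ddt.
have := @C1_cvg_quot _ _ _ _ _ _ basisV g (p t) _ (fun i s => coordV i (diff_quot p t s)) _
  Cg (@cvg_step _ D t) (near_step_neq0 D t) (fun i => cvg_coordV (i := i) pp).
move=> /(_ _ _ _); apply: cvg_trans; apply: near_eq_cvg; apply: nearW => s /=.
rewrite /diff_quot /=; congr (_ * (g _ - _)).
rewrite [RHS](diff_quotK p t s) [in RHS](sum_coordV (diff_quot p t s)).
by rewrite scaler_sumr; under [in RHS]eq_bigr do rewrite scalerA.
Qed.

Lemma cvg_mx (S : Type) (F : set_system S) {FF : Filter F} (m p : nat)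
    (X : S -> 'M[R]_(m, p)) (X0 : 'M[R]_(m, p)) :
  (forall i j, X s i j @[s --> F] --> X0 i j) -> X @ F --> X0.
Proof.
move=> XF; rewrite [X0]matrix_sum_delta.
have -> : X = fun s => \sum_i \sum_j X s i j *: delta_mx i j.
  by apply/funext => s; exact: matrix_sum_delta.
apply: cvg_sumr => i.
apply: cvg_sumr => j.
by apply: cvgZr_tmp.
Qed.

End Coordinates.

(** * Functions that are smooth on a subspace *)

Section Smooth.
Context {R : realType} {V : normedModType R}.
Implicit Types (f g : V -> R^o) (W : set V) (pi : {linear V -> V}).

Lemma derive_comp_linear f pi x v :
  (derivable (f \o pi) x v <-> derivable f (pi x) (pi v)) /\
  'D_v (f \o pi : V -> R^o) x = 'D_(pi v) f (pi x).
Proof.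
rewrite /derivable /derive.
have -> : (fun h : R => h^-1 *: (((f \o pi) \o shift x) (h *: v) - (f \o pi) x)) =
    (fun h => h^-1 *: ((f \o shift (pi x)) (h *: pi v) - f (pi x))).
  by apply/funext => h /=; rewrite (linearD pi) (linearZ_LR pi).
by [].
Qed.

(** Iterated derivatives of [f \o pi] only evaluate [f] at points and in directions
    of the image of [pi]. *)
Lemma iter_derive_comp_linear f pi vs :
  iter_derive (f \o pi : V -> R^o) vs = iter_derive f (map pi vs) \o pi.
Proof.
elim: vs => [//|v vs IH] /=; rewrite IH; apply/funext => x.
by rewrite (derive_comp_linear _ _ _ _).2.
Qed.

Lemma smooth_on_comp_proj W f pi : continuous pi -> (forall x, W (pi x)) ->
  smooth_on W f -> smooth_on [set: V] (f \o pi : V -> R^o).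
Proof.
move=> cpi piW sf vs _; rewrite iter_derive_comp_linear.
have vsW v : v \in map pi vs -> W v by case/mapP => u _ ->.
have [cf df] := sf _ vsW; split.
  apply/continuous_subspaceT => x.
  apply: (@cvg_comp _ _ _ pi _ _ (within W (nbhs (pi x)))); last first.
    by move/subspace_continuousP: cf; exact.
  move=> P HP; have H : nbhs x (pi @^-1` [set y | W y -> P y]) := cpi x _ HP.
  by apply: filterS H => z Hz; apply: Hz; exact: piW.
by move=> x v _ _; apply/(derive_comp_linear _ _ _ _).1; exact: df.
Qed.

Lemma smooth_C1 g : smooth_on [set: V] g -> C1 g.
Proof.
move=> sg; split=> [x v|v].
  by have [_ dg] := sg [::] (fun _ _ => I); exact: dg.
have [+ _] := sg [:: v] (fun _ _ => I).
by move=> cg x K nK; have := cg x K nK; rewrite nbhs_subspaceT.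
Qed.

(** The iterated derivatives of ['D_v g] are those of [g] with [v] taken first. *)
Lemma smooth_derive g v : smooth_on [set: V] g -> smooth_on [set: V] ('D_v g).
Proof.
move=> sg vs _.
have -> : iter_derive ('D_v g) vs = iter_derive g (rcons vs v).
  by elim: vs => //= w vs ->.
exact: sg.
Qed.

End Smooth.

Section Projection.
Context {R : realType} {n : nat}.
Implicit Types (A B : 'M[R]_n).

Lemma dMP A : @dM R n A <-> forall i, \sum_j A i j = 0.
Proof.
rewrite /dM /=; split=> [A0 i|A0].
  have := congr1 (fun M : 'cV[R]_n => M i ord0) A0; rewrite !mxE => A0i.
  rewrite -[RHS]A0i.
  by apply: eq_bigr => j _; rewrite mxE mulr1.
apply/matrixP => i j; rewrite !mxE -[RHS](A0 i).
by apply: eq_bigr => k _; rewrite mxE mulr1.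
Qed.

(** The projection onto [dM] that changes the diagonal only. *)
Definition proj_dM A : 'M[R]_n :=
  \matrix_(i, j) (A i j - (i == j)%:R * \sum_k A i k).

Lemma proj_dM_is_linear : linear proj_dM.
Proof.
move=> a A B; apply/matrixP => i j; rewrite !mxE.
under eq_bigr do rewrite !mxE.
by rewrite big_split /= -mulr_sumr; ring.
Qed.
HB.instance Definition _ := GRing.isLinear.Build R _ _ _ _ proj_dM_is_linear.

Lemma dM_proj A : @dM R n (proj_dM A).
Proof.
apply/dMP => i; under eq_bigr do rewrite mxE.
rewrite sumrB -mulr_suml.
have -> : \sum_j (i == j)%:R = 1 :> R.
  by rewrite (bigD1 i) //= eqxx big1 ?addr0 // => j; rewrite eq_sym => /negPf->.
by rewrite mul1r subrr.
Qed.

Lemma proj_dM_id A : @dM R n A -> proj_dM A = A.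
Proof.
by move/dMP => A0; apply/matrixP => i j; rewrite mxE A0 mulr0 subr0.
Qed.

Lemma dM_linear (a : R) A B : @dM R n A -> @dM R n B -> @dM R n (a *: A + B).
Proof.
by move=> /proj_dM_id <- /proj_dM_id <-; rewrite -linearP; exact: dM_proj.
Qed.

Lemma dM_sum_proj A : @dM R n A ->
  A = \sum_i \sum_j A i j *: proj_dM (delta_mx i j).
Proof.
move=> /proj_dM_id {1}<-; rewrite {1}[A]matrix_sum_delta linear_sum.
by apply: eq_bigr => i _; rewrite linear_sum; apply: eq_bigr => j _; rewrite linearZ.
Qed.

Lemma cvg_proj_dM (S : Type) (F : set_system S) {FF : Filter F} (X : S -> 'M[R]_n) A :
  X @ F --> A -> proj_dM (X s) @[s --> F] --> proj_dM A.
Proof.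
move=> XA; have c i j : X s i j @[s --> F] --> A i j.
  exact: (continuous_cvg _ (@coord_continuous _ _ _ i j A) XA).
apply: cvg_mx => i j; rewrite mxE; under eq_fun do rewrite mxE.
apply: cvgB; first exact: c.
apply: cvgM; first exact: cvg_cst.
by apply: cvg_sumr => k; exact: c.
Qed.

Local Notation V := ('M[R]_n * 'cV[R]_n)%type.
Definition projV (p : V) : V := (proj_dM p.1, p.2).

Lemma projV_is_linear : linear projV.
Proof. by move=> a p q; rewrite /projV /= linearP. Qed.
HB.instance Definition _ := GRing.isLinear.Build R _ _ _ _ projV_is_linear.

Lemma continuous_projV : continuous projV.
Proof.
move=> p.
have c1 : fst @ p --> p.1 by exact: cvg_fst.
have c2 : snd @ p --> p.2 by exact: cvg_snd.
exact: (cvg_pair (cvg_proj_dM c1) c2).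
Qed.

(** Agrees with [l] on [dM] and is smooth everywhere, so that ordinary calculus
    on the whole space applies to it. *)
Definition ext_lagrangian (l : 'M[R]_n -> 'cV[R]_n -> R) : V -> R^o :=
  fun p => l (proj_dM p.1) p.2.

Lemma smooth_ext_lagrangian l : smooth_lagrangian l ->
  smooth_on [set: V] (ext_lagrangian l).
Proof.
move=> sl; apply: (smooth_on_comp_proj (pi := projV) _ _ sl) => [|p].
  exact: continuous_projV.
exact: dM_proj.
Qed.

End Projection.

(** * Pairings and functional derivatives *)

Section Pairings.
Context {R : realType} {n : nat} (K : mesh R n).
Implicit Types (A B X Y L M : 'M[R]_n) (F G h k : 'cV[R]_n).

Lemma OmegaE i j : Omega K i j = tri_area K i *+ (i == j).
Proof. by rewrite !mxE. Qed.

Lemma pair1E L A : pair1 K L A = \sum_i \sum_j L i j * tri_area K i * A i j.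
Proof.
rewrite /pair1 /mxtrace exchange_big /=; apply: eq_bigr => j _.
rewrite mxE; apply: eq_bigr => i _; congr (_ * _).
by rewrite /Omega mul_mx_diag !mxE.
Qed.

Lemma pair0E F G : pair0 K F G = \sum_i F i ord0 * tri_area K i * G i ord0.
Proof.
rewrite /pair0 mxE; apply: eq_bigr => i _; congr (_ * _).
by rewrite /Omega mul_mx_diag !mxE.
Qed.

Lemma pair1_linearr L (a : R) A B : pair1 K L (a *: A + B) = a * pair1 K L A + pair1 K L B.
Proof. by rewrite /pair1 mulmxDr -scalemxAr mxtraceD mxtraceZ. Qed.

Lemma pair1_linearl (a : R) L M A : pair1 K (a *: L + M) A = a * pair1 K L A + pair1 K M A.
Proof. by rewrite /pair1 linearP /= !mulmxDl -!scalemxAl mxtraceD mxtraceZ. Qed.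

Lemma pair1_sumr (I : Type) (r : seq I) (c : I -> R) (A : I -> 'M[R]_n) L :
  pair1 K L (\sum_(i <- r) c i *: A i) = \sum_(i <- r) c i * pair1 K L (A i).
Proof.
elim: r => [|i r IH]; last by rewrite !big_cons pair1_linearr IH.
by rewrite !big_nil /pair1 mulmx0 mxtrace0.
Qed.

Lemma pair1_dM_sum L A : @dM R n A ->
  pair1 K L A = \sum_i \sum_j A i j * pair1 K L (proj_dM (delta_mx i j)).
Proof.
move=> dA; rewrite {1}(dM_sum_proj dA) !pair_bigA /=.
exact: (pair1_sumr _ (fun p => A p.1 p.2)).
Qed.

Lemma pair1_delta i j A : pair1 K (delta_mx i j) A = tri_area K i * A i j.
Proof.
rewrite pair1E (bigD1 i) //= (bigD1 j) //= !mxE !eqxx mul1r.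
rewrite [X in _ + X + _]big1 => [|j' j'j]; last by rewrite mxE (negPf j'j) andbF !mul0r.
rewrite big1 ?addr0 // => i' i'i; apply: big1 => j' _.
by rewrite mxE (negPf i'i) !mul0r.
Qed.

Definition dM_linear_form (phi : 'M[R]_n -> R) : Prop :=
  forall (a : R) A B, @dM R n A -> @dM R n B -> phi (a *: A + B) = a * phi A + phi B.

Lemma dM0 : @dM R n 0.
Proof. by rewrite /dM /= mul0mx. Qed.

Lemma dM_linear_form_sum (phi : 'M[R]_n -> R) (I : Type) (r : seq I) (c : I -> R)
    (A : I -> 'M[R]_n) : dM_linear_form phi -> (forall i, @dM R n (A i)) ->
  @dM R n (\sum_(i <- r) c i *: A i) /\
  phi (\sum_(i <- r) c i *: A i) = \sum_(i <- r) c i * phi (A i).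
Proof.
move=> lphi dA; elim: r => [|i r [d IH]].
  rewrite !big_nil; split; first exact: dM0.
  have := lphi 1 0 0 dM0 dM0; rewrite scaler0 addr0 mul1r => /eqP.
  by rewrite -subr_eq subrr => /eqP.
rewrite !big_cons; split; first exact: dM_linear.
by rewrite lphi // IH.
Qed.

(** Representability: a linear form on [dM] extends to all matrices through the
    projection, and there the pairing is nondegenerate since the areas are
    positive. *)
Lemma dM_dual_reprE (phi : 'M[R]_n -> R) A : dM_linear_form phi -> @dM R n A ->
  pair1 K (dM_dual_repr K phi) A = phi A.
Proof.
move=> lphi; rewrite /dM_dual_repr; case: xgetP => [L _ HL|/(_ (\matrix_(i, j)
  (phi (proj_dM (delta_mx i j)) / tri_area K i))) nex]; first exact: HL.
exfalso; apply: nex => {}A dA /=; rewrite pair1E.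
rewrite [in RHS](dM_sum_proj dA) !pair_bigA /=.
have [_ ->] := @dM_linear_form_sum phi _ (index_enum _) (fun p => A p.1 p.2)
  (fun p => proj_dM (delta_mx p.1 p.2)) lphi (fun p => dM_proj _).
apply: eq_bigr => p _; rewrite mxE divfK 1?mulrC //.
by rewrite gt_eqF // tri_area_gt0.
Qed.

Lemma comm_linearr (A : 'M[R]_n) (a : R) X Y :
  comm A (a *: X + Y) = a *: comm A X + comm A Y.
Proof.
rewrite /comm mulmxDr mulmxDl -scalemxAr -scalemxAl scalerBr.
by rewrite opprD addrACA.
Qed.

Lemma commC A B : comm A B = - comm B A.
Proof. by rewrite /comm opprB. Qed.

Lemma dM_comm A B : @dM R n A -> @dM R n B -> @dM R n (comm A B).
Proof.
rewrite /dM /= => A0 B0.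
by rewrite /comm mulmxBl -!mulmxA A0 B0 !mulmx0 subrr.
Qed.

Lemma pair1_lie_derivative A L B : @dM R n B ->
  pair1 K (lie_derivative K A L) B = pair1 K L (comm A B).
Proof.
move=> dB; rewrite /lie_derivative dM_dual_reprE // => a X Y _ _.
by rewrite comm_linearr pair1_linearr.
Qed.

End Pairings.

Section Gradients.
Context {R : realType} {n : nat} (K : mesh R n).
Implicit Types (A B X Y L M : 'M[R]_n) (F G h k : 'cV[R]_n).
Variables (l C : 'M[R]_n -> 'cV[R]_n -> R).
Local Notation V := ('M[R]_n * 'cV[R]_n)%type.

Lemma derive1_line (W : normedModType R) (f : R -> R^o) (g : W -> R^o) x v :
  (forall e : R, f e = g (x + e *: v)) -> derive1 f 0 = 'D_v g x.
Proof.
move=> fg; rewrite /derive1 /derive.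
suff -> : (fun e : R => e^-1 *: (f (e + 0) - f 0)) =
    (fun e => e^-1 *: ((g \o shift x) (e *: v) - g x)) by [].
by apply/funext => e /=; rewrite !fg scale0r !addr0 [x + _]addrC.
Qed.

(** The representative chosen by [dl_dA] pairs with [dM] as it should, since the
    derivative of [l] is linear in the direction. *)
Lemma pair1_dl_dA A h dA : smooth_lagrangian l -> @dM R n A -> @dM R n dA ->
  pair1 K (dl_dA K l A h) dA = 'D_(dA, 0) (ext_lagrangian l) (A, h).
Proof.
move=> sl dMA dMdA.
have Cg := smooth_C1 (smooth_ext_lagrangian sl).
have E X : @dM R n X -> derive1 (fun e : R^o => l (A + e *: X) h : R^o) 0 =
    'D_(X, 0) (ext_lagrangian l) (A, h).
  move=> dX; apply: derive1_line => e; rewrite /ext_lagrangian /=.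
  by rewrite scaler0 addr0 proj_dM_id // addrC; exact: dM_linear.
rewrite /dl_dA dM_dual_reprE // ?E // => a X Y dX dY.
rewrite !E //; last exact: dM_linear.
have -> : (a *: X + Y, 0) = a *: (X, 0) + (Y, 0) :> V.
  by rewrite [RHS]surjective_pairing /= scaler0 addr0.
by rewrite C1_deriveD // C1_deriveZ.
Qed.

Lemma pair0_dl_dh A h k : smooth_lagrangian l -> @dM R n A ->
  pair0 K (dl_dh K l A h) k = 'D_(0, k) (ext_lagrangian l) (A, h).
Proof.
move=> sl dMA.
have Cg := smooth_C1 (smooth_ext_lagrangian sl).
have E dh : derive1 (fun e : R^o => l A (h + e *: dh) : R^o) 0 =
    'D_(0, dh) (ext_lagrangian l) (A, h).
  apply: derive1_line => e; rewrite /ext_lagrangian /=.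
  by rewrite scaler0 addr0 proj_dM_id.
rewrite /dl_dh; case: xgetP => [F _ HF|/(_ (\col_i
  ('D_(0, delta_mx i ord0) (ext_lagrangian l) (A, h) / tri_area K i))) nex].
  by rewrite HF E.
exfalso; apply: nex => dh /=; rewrite E pair0E.
have -> : (0, dh) = \sum_i dh i ord0 *: (0, delta_mx i ord0) :> V.
  rewrite [LHS]sum_coordV big_sumType /= big1 ?add0r //= => i _.
  by rewrite mxE scale0r.
rewrite C1_derive_sum //; apply: eq_bigr => i _; rewrite mxE divfK 1?mulrC //.
by rewrite gt_eqF // tri_area_gt0.
Qed.

Definition uncurryV (f : 'M[R]_n -> 'cV[R]_n -> R) : V -> R^o := fun p => f p.1 p.2.

(** [C] does not distinguish representatives of one element of the dual, nor does
    its derivative. *)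
Lemma derive_dual_eq M M' h L : smooth_casimir K C -> dM_dual_eq K M M' ->
  'D_(L, 0) (uncurryV C) (M, h) = 'D_(L, 0) (uncurryV C) (M', h).
Proof.
move=> [Ceq _] MM'; rewrite /derive.
suff -> : (fun e : R => e^-1 *: ((uncurryV C \o shift (M, h)) (e *: (L, 0)) -
      uncurryV C (M, h))) =
    (fun e => e^-1 *: ((uncurryV C \o shift (M', h)) (e *: (L, 0)) -
      uncurryV C (M', h))) by [].
apply/funext => e /=; rewrite /uncurryV /=; congr (_ *: (_ - _)); apply: Ceq => // A dA.
by rewrite !pair1_linearl MM'.
Qed.

(** That the gradient lies in [dM]: a matrix with one constant row and zeros
    elsewhere pairs to zero with [dM], so the derivative of [C] along it vanishes,
    and that derivative is a multiple of a row sum of the gradient. *)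
Lemma dC_dMP M h : smooth_casimir K C ->
  @dM R n (dC_dM K C M h) /\ forall L,
    pair1 K L (dC_dM K C M h) = 'D_(L, 0) (uncurryV C) (M, h).
Proof.
move=> sC; have Cg := smooth_C1 sC.2.
have E L : derive1 (fun e : R^o => C (M + e *: L) h : R^o) 0 =
    'D_(L, 0) (uncurryV C) (M, h).
  by apply: derive1_line => e; rewrite /uncurryV /= scaler0 addr0.
have LE L : 'D_(L, 0) (uncurryV C) (M, h) =
    \sum_i \sum_j L i j * 'D_(delta_mx i j, 0) (uncurryV C) (M, h).
  rewrite C1_deriveE // big_sumType /= [X in _ + X]big1 ?addr0.
    by rewrite pair_bigA.
  by move=> i _; rewrite mxE mul0r.
rewrite /dC_dM; case: xgetP => [D _ [dD HD]|/(_ (\matrix_(i, j)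
  ('D_(delta_mx i j, 0) (uncurryV C) (M, h) / tri_area K i))) nex].
  by split => // L; rewrite HD E.
exfalso; apply: nex; split; last first.
  move=> L; rewrite E LE pair1E; apply: eq_bigr => i _; apply: eq_bigr => j _.
  by rewrite mxE -mulrA [_ * (_ / _)]mulrC divfK // gt_eqF // tri_area_gt0.
apply/dMP => i; under eq_bigr do rewrite mxE.
rewrite -mulr_suml.
(* Row [i] of [L] is constant and its other rows vanish: [L] represents zero. *)
set L : 'M[R]_n := \matrix_(i', j) (i' == i)%:R.
have L0 : 'D_(L, 0) (uncurryV C) (M, h) = 0.
  rewrite /derive; apply: cvg_lim; first exact: norm_hausdorff.
  apply: cvg_near_cst; apply: nearW => e /=.
  rewrite /uncurryV /= scaler0 add0r (sC.1 (e *: L + M) M) ?subrr ?scaler0 //.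
  move=> A dA; rewrite pair1_linearl pair1E.
  rewrite big1 ?mulr0 ?add0r // => i' _.
  have /dMP A0 := dA.
  under eq_bigr do rewrite mxE.
  by rewrite -mulr_sumr A0 mulr0.
suff -> : \sum_j 'D_(delta_mx i j, 0) (uncurryV C) (M, h) =
    'D_(L, 0) (uncurryV C) (M, h) by rewrite L0 mul0r.
rewrite LE [RHS](bigD1 i) //= [X in _ + X]big1 ?addr0.
  by apply: eq_bigr => j _; rewrite mxE eqxx mul1r.
by move=> i' i'i; apply: big1 => j _; rewrite mxE (negPf i'i) mul0r.
Qed.

End Gradients.

(** * Elementary exchanges span the constraint space *)

Section ConstraintBasis.
Context {R : realType} {n : nat} (K : mesh R n).
Implicit Types (A B X Y L : 'M[R]_n) (h : 'cV[R]_n).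

Lemma area_neq0 i : tri_area K i != 0.
Proof. by rewrite gt_eqF // tri_area_gt0. Qed.

Lemma constraintP A : constraint K A <-> [/\ @dM R n A,
  (forall i j, i != j -> tri_area K i * A i j = - (tri_area K j * A j i)) &
  forall i j, j \notin nbr K i -> j != i -> A i j = 0].
Proof.
split=> [cA|[dA skA sA]].
  have [dA _ sA] := cA; split=> // i j ij.
  by have := constraint_skew cA ij; rewrite !OmegaE !eqxx.
split=> //; apply/is_diag_mxP => i j ij.
rewrite mxE /Omega mul_diag_mx mul_mx_diag !mxE skA //.
by rewrite mulrC addrN.
Qed.

(** A unit flux across the edge shared by [i] and [j]; the scaling by the areas is
    the one that the constraint dictates. *)
Definition edge_exchange (i j : 'I_n) : 'M[R]_n :=
  if j \in nbr K i then
    (tri_area K i)^-1 *: (delta_mx i j - delta_mx i i)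
    + (tri_area K j)^-1 *: (delta_mx j j - delta_mx j i)
  else 0.

Lemma edge_exchange_off i j k m : j \in nbr K i -> k != m ->
  edge_exchange i j k m = (tri_area K i)^-1 * ((k == i) && (m == j))%:R
    - (tri_area K j)^-1 * ((k == j) && (m == i))%:R.
Proof.
move=> ji km; rewrite /edge_exchange ji !mxE.
have F x : (k == x) && (m == x) = false.
  by apply: contra_neqF km => /andP[/eqP-> /eqP->].
by rewrite !F subr0 sub0r mulrN.
Qed.

Lemma dM_delta_sub (i j k : 'I_n) : @dM R n (delta_mx i j - delta_mx i k).
Proof.
rewrite /dM /= mulmxBl; apply/matrixP => p q.
have E m : (delta_mx i m *m ones R n) p q = (p == i)%:R.
  rewrite mxE (bigD1 m) //= !mxE eqxx andbT mulr1 big1 ?addr0 // => m' m'm.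
  by rewrite !mxE (negPf m'm) andbF mul0r.
by rewrite mxE E mxE E !mxE subrr.
Qed.

Lemma constraint_edge_exchange i j : constraint K (edge_exchange i j).
Proof.
have [ji|nji] := boolP (j \in nbr K i); last first.
  rewrite /edge_exchange (negPf nji); apply/constraintP.
  split=> [|? ? _|? ? _ _]; rewrite ?mxE ?mulr0 ?oppr0 //.
  exact: dM0.
apply/constraintP; split=> [|k m km|k m mk km].
- rewrite /edge_exchange ji; apply: dM_linear; first exact: dM_delta_sub.
  rewrite -[X in @dM R n X]addr0.
  by apply: dM_linear; [exact: dM_delta_sub|exact: dM0].
- have mk : m != k by rewrite eq_sym.
  rewrite !edge_exchange_off // !(andbC (m == _)).
  have [/andP[/eqP-> /eqP->]|_] := boolP ((k == i) && (m == j)).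
    have ij : i == j = false by apply: contraTF ji => /eqP->; rewrite in_nbr eqxx.
    by rewrite ij /= !mulr0 !subr0 sub0r !mulr1 mulrN opprK !divff ?area_neq0.
  have [/andP[/eqP-> /eqP->]|_] := boolP ((k == j) && (m == i)).
    by rewrite !mulr0 !mulr1 sub0r subr0 mulrN !divff ?area_neq0.
  by rewrite !mulr0 subr0 !mulr0 oppr0.
- have k_m : k != m by rewrite eq_sym.
  rewrite edge_exchange_off //.
  have -> : (k == i) && (m == j) = false.
    by apply: contraNF mk => /andP[/eqP-> /eqP->].
  have -> : (k == j) && (m == i) = false.
    by apply: contraNF mk => /andP[/eqP-> /eqP->]; rewrite nbrC.
  by rewrite !mulr0 subr0.
Qed.

Lemma pair1C L A : pair1 K L A = pair1 K A L.
Proof. by rewrite !pair1E; apply: eq_bigr => i _; apply: eq_bigr => j _; ring. Qed.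

Lemma pair1_edge_exchange L i j : j \in nbr K i ->
  pair1 K L (edge_exchange i j) = 2 * Pmap L i j.
Proof.
move=> ji; rewrite /edge_exchange ji.
have PE k m : pair1 K L (delta_mx k m) = tri_area K k * L k m.
  by rewrite pair1C pair1_delta.
have PB k m m' : pair1 K L (delta_mx k m - delta_mx k m') =
    tri_area K k * (L k m - L k m').
  have := pair1_linearr K L (-1) (delta_mx k m') (delta_mx k m).
  by rewrite scaleN1r addrC => ->; rewrite !PE mulN1r addrC mulrBr.
have := pair1_linearr K L (tri_area K i)^-1 (delta_mx i j - delta_mx i i)
  ((tri_area K j)^-1 *: (delta_mx j j - delta_mx j i)).
have := pair1_linearr K L (tri_area K j)^-1 (delta_mx j j - delta_mx j i) 0.
have -> : pair1 K L 0 = 0 by rewrite /pair1 mulmx0 mxtrace0.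
rewrite !addr0 !PB !mulKf ?area_neq0 // => -> ->.
rewrite mxE mulrA divff ?mul1r; last by rewrite pnatr_eq0.
by ring.
Qed.

(** The row sums determine the diagonal. *)
Lemma dM_off_diag A B : @dM R n A -> @dM R n B ->
  (forall i j, i != j -> A i j = B i j) -> A = B.
Proof.
move=> /dMP A0 /dMP B0 AB; apply/matrixP => i j.
have [<-|ij] := eqVneq i j; last exact: AB.
have := A0 i; rewrite -[RHS](B0 i) (bigD1 i) //= [RHS](bigD1 i) //=.
have -> : \sum_(k < n | k != i) A i k = \sum_(k < n | k != i) B i k.
  by apply: eq_bigr => k ki; rewrite AB // eq_sym.
by move/addIr.
Qed.

Lemma constraint_linear (a : R) A B :
  constraint K A -> constraint K B -> constraint K (a *: A + B).
Proof.
move=> /constraintP[dA kA sA] /constraintP[dB kB sB]; apply/constraintP.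
split=> [|i j ij|i j ji ij]; first exact: dM_linear.
  rewrite !mxE mulrDr mulrCA kA // kB // mulrDr [tri_area K j * (a * _)]mulrCA.
  by rewrite mulrN opprD.
by rewrite !mxE sA // sB // mulr0 addr0.
Qed.

Lemma constraint0 : constraint K 0.
Proof.
by apply/constraintP; split=> [|? ? _|? ? _ _]; rewrite ?mxE ?mulr0 ?oppr0 //; exact: dM0.
Qed.

Lemma constraint_sum (I : Type) (r : seq I) (c : I -> R) (A : I -> 'M[R]_n) :
  (forall i, constraint K (A i)) -> constraint K (\sum_(i <- r) c i *: A i).
Proof.
move=> cA; elim: r => [|i r IH]; first by rewrite big_nil; exact: constraint0.
by rewrite big_cons; exact: constraint_linear.
Qed.

Definition exchange_coef (A : 'M[R]_n) (i j : 'I_n) : R := 2^-1 * (tri_area K i * A i j).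

(** Every edge occurs twice in this sum, once in each direction, hence the
    factor 1/2 in the coefficients. *)
Lemma constraint_decomp A : constraint K A ->
  A = \sum_(p : 'I_n * 'I_n) exchange_coef A p.1 p.2 *: edge_exchange p.1 p.2.
Proof.
move=> cA; have /constraintP[dA kA sA] := cA.
apply: dM_off_diag => //.
  have /constraintP[] // : constraint K
    (\sum_(p : 'I_n * 'I_n) exchange_coef A p.1 p.2 *: edge_exchange p.1 p.2).
  by apply: constraint_sum => p; exact: constraint_edge_exchange.
move=> k m km; rewrite summxE.
have [mk|nmk] := boolP (m \in nbr K k); last first.
  rewrite sA // 1?eq_sym // big1 // => -[i j] _ /=; rewrite mxE.
  have /constraintP[_ _ sE] := constraint_edge_exchange i j.
  by rewrite sE ?mulr0 // eq_sym.
have nm : (k, m) != (m, k) by apply: contraNneq km => -[->].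
rewrite (bigD1 (k, m)) //= (bigD1 (m, k)) /=; last by rewrite eq_sym.
rewrite big1 => [|[i j] /= /andP[h1 h2]]; last first.
  rewrite mxE; have [ji|nji] := boolP (j \in nbr K i); last first.
    by rewrite /edge_exchange (negPf nji) mxE mulr0.
  rewrite edge_exchange_off //.
  have -> : (k == i) && (m == j) = false.
    by apply: contraNF h1 => /andP[/eqP-> /eqP->].
  have -> : (k == j) && (m == i) = false.
    by apply: contraNF h2 => /andP[/eqP-> /eqP->].
  by rewrite !mulr0 subr0 mulr0.
rewrite mxE [in X in _ + X]mxE !edge_exchange_off // 1?nbrC // !eqxx (negPf km) /=.
rewrite /exchange_coef [tri_area K m * A m k](_ : _ = - (tri_area K k * A k m)); last first.
  by rewrite kA // eq_sym.
have wm0 := area_neq0 m; have w0 := area_neq0 k.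
by field; rewrite w0 wm0.
Qed.

(** The exchanges span [constraint], and [Pmap] reads off the pairing with each of
    them. *)
Lemma pair1_constraint0 L : (forall i j, j \in nbr K i -> Pmap L i j = 0) <->
  (forall B, constraint K B -> pair1 K L B = 0).
Proof.
split=> [PL B cB|H i j ji]; last first.
  have := H _ (constraint_edge_exchange i j); rewrite pair1_edge_exchange // => /eqP.
  by rewrite mulf_eq0 pnatr_eq0 /= => /eqP.
rewrite (constraint_decomp cB) pair1_sumr big1 // => -[i j] _ /=.
have [ji|nji] := boolP (j \in nbr K i); first by rewrite pair1_edge_exchange // PL // !mulr0.
by rewrite /edge_exchange (negPf nji) /pair1 mulmx0 mxtrace0 mulr0.
Qed.

End ConstraintBasis.

(** * Continuity of the matrix operations *)

Section Continuity.
Context {R : realType} {n : nat} (K : mesh R n).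
Context {S : Type} {F : set_system S} {FF : Filter F}.

Lemma cvg_entry (m p : nat) (X : S -> 'M[R]_(m, p)) (X0 : 'M[R]_(m, p)) i j :
  X @ F --> X0 -> X s i j @[s --> F] --> X0 i j.
Proof. by move=> XF; exact: (continuous_cvg _ (@coord_continuous _ _ _ i j X0) XF). Qed.

Lemma cvg_pair1 (X Y : S -> 'M[R]_n) (X0 Y0 : 'M[R]_n) : X @ F --> X0 -> Y @ F --> Y0 ->
  pair1 K (X s) (Y s) @[s --> F] --> pair1 K X0 Y0.
Proof.
move=> XF YF; rewrite pair1E; under eq_fun do rewrite pair1E.
apply: cvg_sumr => i; apply: cvg_sumr => j.
by apply: cvgM (cvg_entry YF); apply: cvgM (cvg_entry XF) (cvg_cst _).
Qed.

Lemma cvg_mulmx (m p q : nat) (X : S -> 'M[R]_(m, p)) (Y : S -> 'M[R]_(p, q))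
    (X0 : 'M[R]_(m, p)) (Y0 : 'M[R]_(p, q)) :
  X @ F --> X0 -> Y @ F --> Y0 -> (X s *m Y s) @[s --> F] --> X0 *m Y0.
Proof.
move=> XF YF; apply: cvg_mx => i j; rewrite mxE; under eq_fun do rewrite mxE.
by apply: cvg_sumr => k; exact: cvgM (cvg_entry XF) (cvg_entry YF).
Qed.

Lemma cvg_trmx (m p : nat) (X : S -> 'M[R]_(m, p)) (X0 : 'M[R]_(m, p)) :
  X @ F --> X0 -> (X s)^T @[s --> F] --> X0^T.
Proof.
move=> XF; apply: cvg_mx => i j; rewrite mxE; under eq_fun do rewrite mxE.
exact: cvg_entry.
Qed.

Lemma cvg_comm (X Y : S -> 'M[R]_n) (X0 Y0 : 'M[R]_n) : X @ F --> X0 -> Y @ F --> Y0 ->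
  comm (X s) (Y s) @[s --> F] --> comm X0 Y0.
Proof. by move=> XF YF; apply: cvgB; exact: cvg_mulmx. Qed.

Lemma cvg_flat_edge (X : S -> 'M[R]_n) (X0 : 'M[R]_n) i j : X @ F --> X0 ->
  flat_edge K (X s) i j @[s --> F] --> flat_edge K X0 i j.
Proof.
move=> XF; rewrite mxE; under eq_fun do rewrite mxE.
case: ifP => _; last exact: cvg_cst.
by apply: cvgM (cvg_cst _) (cvg_entry XF).
Qed.

Lemma cvg_flat (X : S -> 'M[R]_n) (X0 : 'M[R]_n) :
  X @ F --> X0 -> flat K (X s) @[s --> F] --> flat K X0.
Proof.
move=> XF; apply: cvg_mx => i k; rewrite mxE; under eq_fun do rewrite mxE.
case: ifP => _; first exact: cvg_flat_edge.
(* The triangle and the node used for this entry depend on the mesh alone. *)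
case: pickP => [[j v] _|_]; last exact: cvg_cst.
apply: cvgB; first by apply: cvgD; exact: cvg_flat_edge.
apply: cvgM; first exact: cvg_cst.
by rewrite /circulation; case: ifP => _; apply: cvg_sumr => p; exact: cvg_flat_edge.
Qed.

Lemma cvg_hmul (h : S -> 'cV[R]_n) (X : S -> 'M[R]_n) h0 (X0 : 'M[R]_n) :
  h @ F --> h0 -> X @ F --> X0 ->
  hmul (h s) (X s) @[s --> F] --> hmul h0 X0.
Proof.
move=> hF XF; apply: cvg_mx => i j; rewrite mxE; under eq_fun do rewrite mxE.
exact: cvgM (cvg_entry hF) (cvg_entry XF).
Qed.

Lemma cvg_gamma (h : S -> 'cV[R]_n) (X Y : S -> 'M[R]_n) h0 (X0 Y0 : 'M[R]_n) :
  h @ F --> h0 -> X @ F --> X0 -> Y @ F --> Y0 ->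
  gamma K (h s) (X s) (Y s) @[s --> F] --> gamma K h0 X0 Y0.
Proof.
by move=> hF XF YF; apply: cvg_pair1 YF; apply: cvg_hmul => //; exact: cvg_flat.
Qed.

(** The bracket is bilinear on the finite-dimensional space [dM] times
    [constraint], hence continuous there: expand both arguments. *)
Lemma cvg_bracket br (X Y : S -> 'M[R]_n) (X0 Y0 : 'M[R]_n) : discrete_commutator K br ->
  (\forall s \near F, @dM R n (X s) /\ constraint K (Y s)) ->
  @dM R n X0 -> constraint K Y0 -> X @ F --> X0 -> Y @ F --> Y0 ->
  br (X s) (Y s) @[s --> F] --> br X0 Y0.
Proof.
move=> [_ brl brr] nXY dX0 cY0 XF YF.
have dE (A B : 'M[R]_n) : @dM R n A -> constraint K B -> br A B =
    \sum_(p : 'I_n * 'I_n) \sum_(q : 'I_n * 'I_n)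
      A p.1 p.2 *: (exchange_coef K B q.1 q.2 *:
        br (proj_dM (delta_mx p.1 p.2)) (edge_exchange K q.1 q.2)).
  move=> dA cB.
  have br0l B' : constraint K B' -> br 0 B' = 0.
    move=> cB'; have := brl 1 0 0 B' dM0 dM0 cB'.
    by rewrite scaler0 addr0 scale1r => /eqP; rewrite -subr_eq subrr => /eqP.
  have br0r A' : @dM R n A' -> br A' 0 = 0.
    move=> dA'; have := brr 1 A' 0 0 dA' (constraint0 K) (constraint0 K).
    by rewrite scaler0 addr0 scale1r => /eqP; rewrite -subr_eq subrr => /eqP.
  have suml (r : seq ('I_n * 'I_n)) :
      @dM R n (\sum_(p <- r) A p.1 p.2 *: proj_dM (delta_mx p.1 p.2)) /\
      br (\sum_(p <- r) A p.1 p.2 *: proj_dM (delta_mx p.1 p.2)) B =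
      \sum_(p <- r) A p.1 p.2 *: br (proj_dM (delta_mx p.1 p.2)) B.
    elim: r => [|p r [d IH]]; first by rewrite !big_nil br0l //; split => //; exact: dM0.
    rewrite !big_cons brl // ?IH; last exact: dM_proj.
    by split => //; apply: dM_linear => //; exact: dM_proj.
  have sumr (r : seq ('I_n * 'I_n)) A' : @dM R n A' ->
      br A' (\sum_(q <- r) exchange_coef K B q.1 q.2 *: edge_exchange K q.1 q.2) =
      \sum_(q <- r) exchange_coef K B q.1 q.2 *: br A' (edge_exchange K q.1 q.2).
    move=> dA'; elim: r => [|q r IH]; first by rewrite !big_nil br0r.
    rewrite !big_cons brr ?IH //; first exact: constraint_edge_exchange.
    by apply: constraint_sum => ?; exact: constraint_edge_exchange.
  rewrite {1}(dM_sum_proj dA) pair_bigA /= (suml _).2.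
  apply: eq_bigr => p _; rewrite {1}(constraint_decomp cB) sumr; last exact: dM_proj.
  by rewrite scaler_sumr.
rewrite (dE _ _ dX0 cY0).
have : (\sum_(p : 'I_n * 'I_n) \sum_(q : 'I_n * 'I_n)
      X s p.1 p.2 *: (exchange_coef K (Y s) q.1 q.2 *:
        br (proj_dM (delta_mx p.1 p.2)) (edge_exchange K q.1 q.2))) @[s --> F] -->
    \sum_(p : 'I_n * 'I_n) \sum_(q : 'I_n * 'I_n)
      X0 p.1 p.2 *: (exchange_coef K Y0 q.1 q.2 *:
        br (proj_dM (delta_mx p.1 p.2)) (edge_exchange K q.1 q.2)).
  apply: cvg_sumr => p; apply: cvg_sumr => q.
  apply: cvgZ; first exact: cvg_entry.
  apply: cvgZr_tmp; apply: cvgM (cvg_cst _) _; apply: cvgM (cvg_cst _) _.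
  exact: cvg_entry.
apply: cvg_trans; apply: near_eq_cvg.
by apply: filterS nXY => s [dXs cYs]; rewrite dE.
Qed.

End Continuity.

(** * Calculus on a compact time interval *)

Section Interval.
Context {R : realType} {T : R}.
Hypothesis T0 : 0 < T.
Local Notation D := (`[0, T]%classic : set R).
Local Notation mu := (@lebesgue_measure R).
Implicit Types (f g F : R -> R).

Definition cont_on (V : topologicalType) (f : R -> V) : Prop :=
  forall t, D t -> f s @[s --> within D (nbhs t)] --> f t.

Lemma cont_onP (V : topologicalType) (f : R -> V) :
  cont_on f <-> {within D, continuous f}.
Proof. by split=> /subspace_continuousP. Qed.

Lemma eq_cont_on (V : topologicalType) (f g : R -> V) :
  (forall t, D t -> f t = g t) -> cont_on f -> cont_on g.
Proof.
move=> fg cf t Dt; rewrite -fg //; have := cf t Dt.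
apply: cvg_trans; apply: near_eq_cvg; rewrite near_withinE.
by apply: nearW => s Ds; rewrite fg.
Qed.

Lemma measurable_D : measurable (D : set (measurableTypeR R)).
Proof. exact: measurable_itv. Qed.

Lemma cont_integrable f : cont_on f -> mu.-integrable D (EFin \o f).
Proof.
move=> /cont_onP cf; apply: continuous_compact_integrable => //.
exact: segment_compact.
Qed.

Lemma has_ddt_cont (V : normedModType R) (f f' : R -> V) :
  (forall t, D t -> has_ddt D f t (f' t)) -> cont_on f.
Proof. by move=> ff t Dt; exact: has_ddt_cvg (ff t Dt). Qed.

Lemma proper_D t : D t -> ProperFilter (within D t^').
Proof. by move=> Dt; exact: proper_within_itv. Qed.

Lemma has_ddt_derive f t l : t \in `]0, T[ -> has_ddt D (f : R -> R^o) t l ->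
  is_derive t 1 (f : R -> R^o) l.
Proof.
move=> tT fl.
have cth : (h + t) @[h --> (0 : R)] --> t.
  have : (h + t) @[h --> (0 : R)] --> (0 : R) + t.
    by apply: cvgD; [exact: cvg_id|exact: cvg_cst].
  by rewrite add0r.
have sh : (h + t) @[h --> (0 : R)^'] --> within D t^'.
  move=> P HP.
  have H1 : \forall h \near (0 : R), h + t != t -> D (h + t) -> P (h + t).
    exact: cth _ HP.
  have H2 : \forall h \near (0 : R), D (h + t).
    have := near_in_itvoo tT => /cth; apply: filterS => h /=.
    by rewrite !in_itv /= => /andP[/ltW-> /ltW->].
  change (\forall h \near (0 : R)^', P (h + t)); rewrite near_withinE.
  near=> h => h0.
  have H1h : h + t != t -> D (h + t) -> P (h + t) by near: h.
  by apply: H1h; [rewrite -subr_eq0 addrK|near: h].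
have : (diff_quot (f : R -> R^o) t \o (fun h => h + t)) h @[h --> (0 : R)^'] --> l.
  exact: cvg_comp sh fl.
rewrite (_ : _ \o _ = fun h => h^-1 *: (f (h *: 1 + t) - f t)); last first.
  by apply/funext => h; rewrite /diff_quot /= addrK [h *: 1]mulr1.
move=> H; apply: DeriveDef; first by apply/cvg_ex; exists l.
by apply/cvg_lim => //; exact: norm_hausdorff.
Unshelve. all: by end_near. Qed.

Lemma FTC_within f F : (forall t, D t -> has_ddt D (F : R -> R^o) t (f t)) ->
  cont_on f -> \int[mu]_(t in D) f t = F T - F 0.
Proof.
move=> Ff cf.
have cF : {within D, continuous F} by apply/cont_onP; exact: has_ddt_cont Ff.
rewrite /Rintegral (@continuous_FTC2 _ f F) //.
- exact/cont_onP.
- have /(continuous_within_itvP _ T0)[_ F0 FT] := cF.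
  split=> // t tT.
  have Dt : D t by exact: subset_itv_oo_cc tT.
  by case: (has_ddt_derive tT (Ff t Dt)).
- move=> t tT; have Dt : D t by exact: subset_itv_oo_cc tT.
  by rewrite derive1E; case: (has_ddt_derive tT (Ff t Dt)).
Qed.

Lemma derivable_has_ddt f t : derivable (f : R -> R^o) t 1 ->
  has_ddt D (f : R -> R^o) t (f^`()%classic t).
Proof.
move=> df.
have sh : (s - t) @[s --> within D t^'] --> (0 : R)^'.
  move=> P HP.
  have H1 : \forall s \near within D t^', s - t != 0 -> P (s - t).
    exact: cvg_step _ HP.
  change (\forall s \near within D t^', P (s - t)).
  near=> s; have H2 : s - t != 0 -> P (s - t) by near: s.
  by apply: H2; near: s; exact: near_step_neq0.
have : h^-1 *: (f (h *: 1 + t) - f t) @[h --> (0 : R)^'] --> f^`()%classic t.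
  by rewrite derive1E; exact: df.
move=> /(cvg_comp _ _ sh); rewrite /has_ddt; apply: cvg_trans.
apply: near_eq_cvg; apply: nearW => s.
by rewrite /diff_quot /= [_ *: 1]mulr1 subrK.
Unshelve. all: by end_near. Qed.

Lemma has_ddt_horner (q : {poly R}) t : has_ddt D (horner q : R -> R^o) t q^`().[t].
Proof.
have -> : q^`().[t] = (horner q)^`()%classic t by rewrite -derivE.
exact/derivable_has_ddt/derivable_horner.
Qed.

(** The iterated one-sided derivatives of a polynomial are polynomials, so it is
    smooth up to the endpoints; this makes polynomials convenient as test
    functions. *)
Lemma smooth_curve_poly (V : normedModType R) (q : {poly R}) (E : V) :
  smooth_curve D (fun t => q.[t] *: E).
Proof.
have itE k : forall t, D t ->
    iter k (@ddt R D V) (fun t => q.[t] *: E) t = q^`(k).[t] *: E.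
  elim: k => [//|k IH t Dt /=].
  apply: has_ddt_unique; first exact: proper_D.
  apply: (@eq_has_ddt _ _ _ (fun t => q^`(k).[t] *: E)) => //.
    by move=> s Ds; rewrite IH.
  by apply: has_ddtZ; exact: has_ddt_horner.
move=> k t Dt.
suff H : has_ddt D (iter k (@ddt R D V) (fun t => q.[t] *: E)) t (q^`(k.+1).[t] *: E).
  exact: cvgP H.
apply: (@eq_has_ddt _ _ _ (fun t => q^`(k).[t] *: E)) => //.
  by move=> s Ds; rewrite itE.
by rewrite derivnS; apply: has_ddtZ; exact: has_ddt_horner.
Qed.

Lemma smooth_has_ddt (V : normedModType R) (f : R -> V) t :
  smooth_curve D f -> D t -> has_ddt D f t (ddt D f t).
Proof. by move=> sf Dt; apply: has_ddtP; exact: sf 0%N t Dt. Qed.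

Lemma smooth_cont (V : normedModType R) (f : R -> V) : smooth_curve D f -> cont_on f.
Proof. by move=> sf; apply: has_ddt_cont => t Dt; exact: smooth_has_ddt. Qed.

Lemma smooth_ddt_cont (V : normedModType R) (f : R -> V) :
  smooth_curve D f -> cont_on (ddt D f).
Proof.
move=> sf; apply: has_ddt_cont => t Dt; apply: has_ddtP; exact: sf 1%N t Dt.
Qed.

Section UnderIntegral.
Context {n : nat}.
Local Notation V := ('M[R]_n * 'cV[R]_n)%type.

(** The derivative is jointly continuous in the parameter, the point and the
    direction, and these range over a compact set; the bound dominates the
    difference quotients under the integral. *)
Lemma derivative_bounded (g : V -> R^o) (p v : R -> V) : C1 g ->
  cont_on p -> cont_on v ->
  exists B : R, forall (e t : R), e \in `[-1, 1] -> D t ->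
    `|'D_(v t) g (p t + e *: v t)| <= B.
Proof.
move=> Cg /cont_onP cp /cont_onP cv.
pose Psi (z : R * (V * V)) : R := 'D_(z.2.2) g (z.2.1 + z.1 *: z.2.2).
have cPsi : continuous Psi.
  move=> z; rewrite /continuous_at /Psi.
  have c1 : fst @ z --> z.1 by exact: cvg_fst.
  have c2 : snd @ z --> z.2 by exact: cvg_snd.
  have c21 : (fun z : R * (V * V) => z.2.1) @ z --> z.2.1.
    by apply: continuous_cvg c2; exact: cvg_fst.
  have c22 : (fun z : R * (V * V) => z.2.2) @ z --> z.2.2.
    by apply: continuous_cvg c2; exact: cvg_snd.
  apply: cvg_C1_derive => //.
  by apply: cvgD => //; exact: cvgZ.
have cK : compact (`[(-1 : R), 1]%classic `*` ((p @` D) `*` (v @` D))).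
  apply: compact_setX; first exact: segment_compact.
  by apply: compact_setX; apply: continuous_compact => //; exact: segment_compact.
have /compact_bounded[B [_ HB]] :
    compact (Psi @` (`[(-1 : R), 1]%classic `*` ((p @` D) `*` (v @` D)))).
  by apply: continuous_compact cK; exact: continuous_subspaceT.
exists (B + 1) => e t e1 Dt.
apply: (HB (B + 1)); first by rewrite ltrDl.
by exists (e, (p t, v t)) => //; split => //=; split; exists t.
Qed.

Lemma derive1_integral (g : V -> R^o) (p v : R -> V) : C1 g -> continuous g ->
  cont_on p -> cont_on v ->
  derive1 (fun e : R^o => (\int[mu]_(t in D) g (p t + e *: v t)) : R^o) 0 =
  \int[mu]_(t in D) 'D_(v t) g (p t).
Proof.
move=> Cg cg cp cv.
have [B HB] := derivative_bounded Cg cp cv.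
pose f (e t : R) : R := g (p t + e *: v t).
have df (e t : R) : is_derive e (1 : R^o) (fun e : R^o => f e t : R^o)
    ('D_(v t) g (p t + e *: v t)).
  by apply: is_derive_line; exact: Cg.1.
have partE e t : partial1of2 f e t = 'D_(v t) g (p t + e *: v t).
  by rewrite partial1of2E; case: (df e t).
have B0 : 0 <= B.
  have D0 : D 0 by rewrite /= in_itv /= lexx ltW.
  by apply: le_trans (HB 0 0 _ D0); rewrite ?normr_ge0 // in_itv /= lerN10 ler01.
have fint e : (`]-1, 1[%classic : set R) e -> mu.-integrable D (EFin \o f e).
  move=> _; apply: cont_integrable => t Dt.
  apply: (continuous_cvg _ (cg (p t + e *: v t))).
  by apply: cvgD; [exact: cp|apply: cvgZ; [exact: cvg_cst|exact: cv]].
have dfx e t : derivable (f^~ t : R^o -> R^o) e 1 by case: (df e t).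
have := @differentiation_under_integral R _ _ mu f D measurable_D 0 (-1) 1 _ fint
  (fun e t _ _ => dfx e t) (cst B).
rewrite /= => ->.
- by apply: eq_Rintegral => t _; rewrite partE scale0r addr0.
- by rewrite in_itv /= ltrN10 ltr01.
- by [].
- by apply: cont_integrable => t Dt; exact: cvg_cst.
- move=> e t e1 Dt; rewrite partE; apply: HB => //.
  exact: subset_itv_oo_cc e1.
Qed.

End UnderIntegral.
End Interval.

(** * The fundamental lemma of the calculus of variations *)

Section FundamentalLemma.
Context {R : realType} {T : R}.
Hypothesis T0 : 0 < T.
Local Notation D := (`[0, T]%classic : set R).
Local Notation mu := (@lebesgue_measure R).
Implicit Types (f g : R -> R).

Local Notation cont := (@cont_on R T R).

Lemma contM f g : cont f -> cont g -> cont (fun t => f t * g t).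
Proof. by move=> cf cg t Dt; exact: cvgM (cf t Dt) (cg t Dt). Qed.

Lemma contD f g : cont f -> cont g -> cont (fun t => f t + g t).
Proof. by move=> cf cg t Dt; exact: cvgD (cf t Dt) (cg t Dt). Qed.

Lemma cont_cst (c : R) : cont (fun=> c).
Proof. by move=> t Dt; exact: cvg_cst. Qed.

Lemma cont_horner (q : {poly R}) : cont (horner q).
Proof. by apply: has_ddt_cont => t Dt; exact: has_ddt_horner. Qed.

Lemma fine_measure_itv (a b : R) : a <= b ->
  fine (mu (`[a, b]%classic : set R)) = b - a.
Proof.
move=> ab; rewrite lebesgue_measure_itv /= lte_fin.
by case: ltrP => // ba; rewrite (le_anti (introT andP (conj ab ba))) subrr.
Qed.

(** Add [k] to make the integrand nonnegative, then discard the part of the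
    integral outside [[a, b]]. *)
Lemma Rintegral_lower_bound f (a b c k : R) : 0 <= a -> a <= b -> b <= T ->
  cont f -> (forall t, D t -> - k <= f t) ->
  (forall t, t \in `[a, b] -> c <= f t) -> 0 <= k ->
  c * (b - a) - k * T <= \int[mu]_(t in D) f t.
Proof.
move=> a0 ab bT cf kf cf' k0.
have JD : (`[a, b]%classic : set R) `<=` D.
  move=> t /=; rewrite !in_itv /= => /andP[at_ tb].
  by rewrite (le_trans a0 at_) (le_trans tb bT).
have mJ : measurable (`[a, b]%classic : set (measurableTypeR R)) by exact: measurable_itv.
have cfk : cont (fun t => f t + k) by apply: contD => //; exact: cont_cst.
have ifk := cont_integrable cfk.
have ifkJ := integrableS (measurable_D (T := T)) mJ JD ifk.
have ik : mu.-integrable D (EFin \o cst k) by apply: cont_integrable; exact: cont_cst.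
have E1 : \int[mu]_(t in D) (f t + k) = \int[mu]_(t in D) f t + k * T.
  rewrite (RintegralD (measurable_D (T := T)) (cont_integrable cf) ik).
  congr (_ + _); rewrite (Rintegral_cst _ (measurable_D (T := T))).
  by rewrite (fine_measure_itv (ltW T0)) subr0.
have E2 : \int[mu]_(t in `[a, b]) (f t + k) <= \int[mu]_(t in D) (f t + k).
  rewrite /Rintegral fine_le //.
  - exact: integrable_fin_num.
  - exact: integrable_fin_num.
  - apply: ge0_subset_integral => //.
      by case/integrableP : ifk.
    by move=> t Dt; rewrite lee_fin -lerBlDr sub0r; exact: kf.
have E3 : c * (b - a) <= \int[mu]_(t in `[a, b]) (f t + k).
  rewrite -(fine_measure_itv ab) -(Rintegral_cst _ mJ); have ic := cont_integrable (@cont_cst c).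
  apply: le_Rintegral => //; first exact: (integrableS (measurable_D (T := T)) mJ JD ic).
  by move=> t tJ; rewrite (le_trans (cf' t tJ)) // lerDl.
by rewrite lerBlDr (le_trans E3) // (le_trans E2) // E1.
Qed.

(** Landau's kernel: a power of [1 - ((t - t0) / T) ^ 2] is largest at [t0] and
    exponentially smaller away from it; the factor [t * (T - t)] makes it vanish
    at the ends of the interval. *)
Definition landau_poly (t0 : R) (k : nat) : {poly R} :=
  'X * (T%:P - 'X) * (1 - (T ^- 2) *: ('X - t0%:P) ^+ 2) ^+ k.

Lemma landau_polyE t0 k t :
  (landau_poly t0 k).[t] = t * (T - t) * (1 - T ^- 2 * (t - t0) ^+ 2) ^+ k.
Proof. by rewrite /landau_poly !hornerE. Qed.

(** Were [f] positive at [t0], then for large [k] the product of [f] with the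
    kernel would have a positive integral: on an interval near [t0] the kernel is
    at least a multiple of [r1 ^+ k], away from [t0] it is at most a multiple of
    [r2 ^+ k], and [r2 < r1]. *)
Lemma poly_test_le0 f : cont f ->
  (forall q : {poly R}, q.[0] = 0 -> q.[T] = 0 ->
     \int[mu]_(t in D) (q.[t] * f t) = 0) ->
  forall t, D t -> f t <= 0.
Proof.
move=> cf H t0 Dt0; rewrite leNgt; apply/negP => f0.
have t0T : 0 <= t0 <= T by move: Dt0; rewrite /= in_itv.
have c0 : 0 < f t0 / 2 by rewrite divr_gt0.
have [d d0 Hd] : exists2 d : R, 0 < d & forall t, D t -> `|t - t0| < d -> f t0 / 2 <= f t.
  have /cvgrPdist_lt/(_ _ c0) := cf t0 Dt0; rewrite near_withinE.
  move=> /nbhs_ballP[d /= d0 Hd]; exists d => // t Dt td.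
  have : `|f t0 - f t| < f t0 / 2 by apply: Hd => //; rewrite /ball /= distrC.
  by rewrite ltr_norml => /andP[_]; lra.
have [c Dc Hc] : exists2 c : R, 0 <= c & forall t, D t -> - c <= f t.
  have /cont_onP := cf => /(EVT_min (ltW T0))[c _ Hc].
  exists `|f c| => // t Dt; rewrite (le_trans _ (Hc t Dt)) // lerNl.
  by rewrite -normrN ler_norm.
pose e := Num.min d T.
have e0 : 0 < e by rewrite lt_min d0 T0.
have ed : e <= d by rewrite ge_min lexx.
have eT : e <= T by rewrite ge_min lexx orbT.
(* [[a, b]] avoids the ends of [0, T], where the factor [t * (T - t)] vanishes;
   if [t0 = T] it lies to the left of [t0]. *)
have [a [b [a0 [ab [bT Hab]]]]] : exists a b : R, 0 < a /\ a < b /\ b < T /\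
    forall t, t \in `[a, b] -> `|t - t0| <= e / 2.
  have [t0lT|Tt0] := ltrP t0 T.
    pose e' := Num.min e (T - t0).
    have e'0 : 0 < e' by rewrite lt_min e0 subr_gt0.
    have e'e : e' <= e by rewrite ge_min lexx.
    have e'T : e' <= T - t0 by rewrite ge_min lexx orbT.
    exists (t0 + e' / 8), (t0 + e' / 4); split; first lra.
    split; first lra.
    split; first lra.
    by move=> t; rewrite in_itv /= => /andP[? ?]; rewrite ger0_norm; lra.
  exists (T - e / 4), (T - e / 8); split; first lra.
  split; first lra.
  split; first lra.
  by move=> t; rewrite in_itv /= => /andP[? ?]; rewrite ler0_norm; lra.
pose w (t : R) : R := 1 - T ^- 2 * (t - t0) ^+ 2.
pose r1 : R := 1 - T ^- 2 * (e / 2) ^+ 2.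
pose r2 : R := 1 - T ^- 2 * e ^+ 2.
have TN2 : 0 < T ^- 2 by rewrite invr_gt0 exprn_gt0.
have r2_ge0 : 0 <= r2.
  rewrite subr_ge0 mulrC ler_pdivrMr ?exprn_gt0 // mul1r.
  by rewrite ler_sqr ?nnegrE // ltW.
have r21 : r2 < r1.
  rewrite ltrD2l ltrN2 ltr_pM2l //.
  by rewrite ltr_sqr ?nnegrE ?divr_ge0 ?(ltW e0) //; lra.
have r1_gt0 : 0 < r1 by exact: le_lt_trans r21.
have w_ge0 t : D t -> 0 <= w t.
  rewrite /= in_itv /= => /andP[tt0 tT].
  rewrite subr_ge0 mulrC ler_pdivrMr ?exprn_gt0 // mul1r.
  by rewrite -real_normK ?num_real // ler_sqr ?nnegrE ?normr_ge0 ?(ltW T0) // ler_norml; lra.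
have w_near t : t \in `[a, b] -> r1 <= w t.
  move=> /Hab te; rewrite lerD2l lerN2 ler_pM2l // -(real_normK (num_real (t - t0))).
  by rewrite ler_sqr ?nnegrE ?normr_ge0 ?divr_ge0 ?(ltW e0).
have w_far t : e <= `|t - t0| -> w t <= r2.
  move=> te; rewrite lerD2l lerN2 ler_pM2l // -(real_normK (num_real (t - t0))).
  by rewrite ler_sqr ?nnegrE ?normr_ge0 ?(ltW e0).
pose m := a * (T - b).
have m0 : 0 < m by rewrite mulr_gt0 // subr_gt0.
have key k : m * (f t0 / 2) * (b - a) * r1 ^+ k <= T ^+ 2 * c * T * r2 ^+ k.
  have := H (landau_poly t0 k).
  rewrite !landau_polyE mul0r mul0r subrr mulr0 mul0r => /(_ erefl erefl) H0.
  have := @Rintegral_lower_bound (fun t => (landau_poly t0 k).[t] * f t) a b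
    (m * r1 ^+ k * (f t0 / 2)) (T ^+ 2 * r2 ^+ k * c) (ltW a0) (ltW ab) (ltW bT).
  rewrite H0 => LB.
  suff : m * r1 ^+ k * (f t0 / 2) * (b - a) - T ^+ 2 * r2 ^+ k * c * T <= 0 by lra.
  apply: LB.
  - by apply: contM => //; exact: cont_horner.
  - move=> t Dt; rewrite landau_polyE -/(w t).
    have tT : 0 <= t <= T by move: Dt; rewrite /= in_itv.
    have p0 : 0 <= t * (T - t) by rewrite mulr_ge0 //; lra.
    have P0 : 0 <= t * (T - t) * w t ^+ k by rewrite mulr_ge0 // exprn_ge0 ?w_ge0.
    have [tn|tf] := ltrP `|t - t0| e.
      have ft : 0 <= f t by apply: le_trans (ltW c0) (Hd t Dt (lt_le_trans tn ed)).
      apply: (@le_trans _ _ 0); last exact: mulr_ge0.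
      by rewrite oppr_le0 !mulr_ge0 // ?exprn_ge0 // ltW.
    have P1 : t * (T - t) * w t ^+ k <= T ^+ 2 * r2 ^+ k.
      apply: ler_pM => //; rewrite ?exprn_ge0 ?w_ge0 //; first by nra.
      by apply: lerXn2r; rewrite ?nnegrE ?w_ge0 // w_far.
    have := Hc t Dt; nra.
  - move=> t tab; rewrite landau_polyE -/(w t).
    have /andP[at_ tb] : a <= t <= b by move: tab; rewrite in_itv.
    have Dt : D t by rewrite /= in_itv /=; lra.
    have td : `|t - t0| < d by rewrite (le_lt_trans (Hab t tab)) //; lra.
    have h1 : m <= t * (T - t) by rewrite /m; apply: ler_pM; lra.
    have h2 : r1 ^+ k <= w t ^+ k.
      by apply: lerXn2r; rewrite ?nnegrE ?w_near ?w_ge0 ?(ltW r1_gt0).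
    have h3 : 0 <= r1 ^+ k by rewrite exprn_ge0 // ltW.
    have h4 : m * r1 ^+ k <= t * (T - t) * w t ^+ k.
      by apply: ler_pM => //; exact: ltW.
    apply: ler_pM (Hd t Dt td) => //; last exact: ltW.
    by rewrite mulr_ge0 // ltW.
  - by rewrite !mulr_ge0 // ?exprn_ge0 // ltW.
(* Divide [key] by [r1 ^+ k] and let [k] tend to infinity. *)
have r0 : `|r2 / r1| < 1.
  by rewrite ger0_norm ?divr_ge0 ?(ltW r1_gt0) // ltr_pdivrMr // mul1r.
have : T ^+ 2 * c * T * (r2 / r1) ^+ k @[k --> \oo] --> T ^+ 2 * c * T * 0.
  by apply: cvgM (cvg_cst _) _; exact: cvg_expr.
rewrite mulr0 => lim0.
have : m * (f t0 / 2) * (b - a) <= 0.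
  apply: (cvgr_to_ge lim0); apply: nearW => k.
  by rewrite expr_div_n [leRHS]mulrA ler_pdivlMr ?exprn_gt0.
by rewrite leNgt !mulr_gt0 // subr_gt0.
Qed.

(** The previous lemma for [f] and for [- f]. *)
Lemma poly_test_eq0 f : cont f ->
  (forall q : {poly R}, q.[0] = 0 -> q.[T] = 0 ->
     \int[mu]_(t in D) (q.[t] * f t) = 0) ->
  forall t, D t -> f t = 0.
Proof.
move=> cf H t Dt; apply/eqP; rewrite eq_le; apply/andP; split.
  exact: poly_test_le0 Dt.
rewrite -oppr_le0; apply: (@poly_test_le0 (fun t => - f t)) Dt.
  by move=> s Ds; apply: cvgN; exact: cf.
move=> q q0 qT.
have := H (- q); rewrite !hornerN q0 qT oppr0 => /(_ erefl erefl) Hq.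
by rewrite -[RHS]Hq; apply: eq_Rintegral => s _; rewrite hornerN mulrN mulNr.
Qed.

End FundamentalLemma.

(** * The first variation and the equations of motion *)

Section EulerPoincare.
Context {R : realType} {n : nat} (K : mesh R n).
Variables (br : 'M[R]_n -> 'M[R]_n -> 'M[R]_n).
Variables (l C : 'M[R]_n -> 'cV[R]_n -> R) (theta T : R).
Variables (A : R -> 'M[R]_n) (h : R -> 'cV[R]_n).
Local Notation D := (`[0, T]%classic : set R).
Local Notation mu := (@lebesgue_measure R).
Local Notation V := ('M[R]_n * 'cV[R]_n)%type.
Local Notation cont := (@cont_on R T).
Hypotheses (brK : discrete_commutator K br) (sl : smooth_lagrangian l)
  (sC : smooth_casimir K C) (T0 : 0 < T)
  (sA : smooth_curve D A) (cA : forall t, D t -> constraint K (A t))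
  (sh : smooth_curve D h).

Let g : V -> R^o := ext_lagrangian l.
Let p (t : R) : V := (A t, h t).
Let p' (t : R) : V := (ddt D A t, ddt D h t).

(* [M] is the momentum, [Mdot] its rate of change, [F] the derivative of the
   Lagrangian in [h], [X] the bracket in the dissipation term, and [Z] the
   residual of the equations of motion. Apart from [X] they matter only through
   their pairings, which do not depend on the choice of representatives. *)
Variables (M Mdot X Z : R -> 'M[R]_n) (F : R -> 'cV[R]_n).
Hypotheses (ME : M = fun t => dl_dA K l (A t) (h t))
  (FE : F = fun t => dl_dh K l (A t) (h t))
  (XE : X = fun t => br (dC_dM K C (M t) (h t)) (A t))
  (MdotE : Mdot = dM_dual_ddt K D M)
  (ZE : Z = fun t => Mdot t + lie_derivative K (A t) (M t)
    - theta *: lie_derivative K (A t) (hmul (h t) (flat K (X t))) + h t *m (F t)^T).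

Let sg : smooth_on [set: V] g := smooth_ext_lagrangian sl.
Let Cg : C1 g := smooth_C1 sg.

Lemma constraint_dM B : constraint K B -> @dM R n B.
Proof. by case. Qed.

Lemma cont_g : continuous g.
Proof.
have [+ _] := sg (fun v (_ : v \in [::]) => I).
by move=> cg x P nP; have := cg x P nP; rewrite nbhs_subspaceT.
Qed.

Lemma has_ddt_p t : D t -> has_ddt D p t (p' t).
Proof. by move=> Dt; apply: has_ddt_pair; exact: smooth_has_ddt. Qed.

Lemma cont_A : cont A. Proof. exact: smooth_cont. Qed.
Lemma cont_h : cont h. Proof. exact: smooth_cont. Qed.
Lemma cont_p : cont p. Proof. by apply: has_ddt_cont has_ddt_p. Qed.
Lemma cont_p' : cont p'.
Proof.
by move=> t Dt; exact: (cvg_pair (smooth_ddt_cont sA Dt) (smooth_ddt_cont sh Dt)).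
Qed.

Lemma pair1_M t E : D t -> @dM R n E -> pair1 K (M t) E = 'D_(E, 0) g (p t).
Proof. by move=> Dt dE; rewrite ME pair1_dl_dA //; exact/constraint_dM/cA. Qed.

Lemma pair0_F t k : D t -> pair0 K (F t) k = 'D_(0, k) g (p t).
Proof. by move=> Dt; rewrite FE pair0_dl_dh //; exact/constraint_dM/cA. Qed.

Lemma has_ddt_M t E : D t -> @dM R n E ->
  has_ddt D (fun s => pair1 K (M s) E : R^o) t ('D_(p' t) ('D_(E, 0) g) (p t)).
Proof.
move=> Dt dE; apply: (@eq_has_ddt _ _ _ (('D_(E, 0) g : V -> R^o) \o p)) => //.
  by move=> s Ds; rewrite pair1_M.
by apply: C1_chain (has_ddt_p Dt); apply/smooth_C1/smooth_derive.
Qed.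

(** Each pairing [pair1 K (M s) E] is a derivative of the Lagrangian along the
    curve [p], hence differentiable in time by the chain rule; its derivative is
    linear in [E], so that it has a representative. *)
Lemma pair1_Mdot t E : D t -> @dM R n E ->
  pair1 K (Mdot t) E = 'D_(p' t) ('D_(E, 0) g) (p t).
Proof.
move=> Dt dE; have PD := proper_D T0 Dt.
have ddtP Y : @dM R n Y -> has_ddt D (fun s => pair1 K (M s) Y : R^o) t
    (ddt D (fun s => pair1 K (M s) Y : R^o) t).
  by move=> dY; exact: cvgP (has_ddt_M Dt dY).
rewrite MdotE /dM_dual_ddt dM_dual_reprE //; last first.
  move=> a Y Y' dY dY'; apply: has_ddt_unique.
  have H := has_ddt_lincomb (a := a) (ddtP Y dY) (ddtP Y' dY').
  by apply: (eq_has_ddt Dt _ H) => s Ds; rewrite pair1_linearr.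
exact: (has_ddt_unique PD (has_ddt_M Dt dE)).
Qed.

Lemma cont_pair1_M Y : (forall t, D t -> @dM R n (Y t)) -> cont Y ->
  cont (fun t => pair1 K (M t) (Y t)).
Proof.
move=> dY cY; apply: (@eq_cont_on _ _ _ (fun t => 'D_(Y t, 0) g (p t))).
  by move=> t Dt; rewrite pair1_M //; exact: dY.
move=> t Dt; apply: cvg_C1_derive => //; first exact: cont_p.
exact: (cvg_pair (cY t Dt) (cvg_cst _)).
Qed.

Lemma cont_pair1_Mdot Y : (forall t, D t -> @dM R n (Y t)) -> cont Y ->
  cont (fun t => pair1 K (Mdot t) (Y t)).
Proof.
move=> dY cY.
apply: (@eq_cont_on _ _ _ (fun t => \sum_i \sum_j
    Y t i j * 'D_(p' t) ('D_(proj_dM (delta_mx i j), 0) g) (p t))).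
  move=> t Dt; rewrite (pair1_dM_sum _ _ (dY t Dt)).
  by apply: eq_bigr => i _; apply: eq_bigr => j _; rewrite pair1_Mdot //; exact: dM_proj.
move=> t Dt; apply: cvg_sumr => i; apply: cvg_sumr => j.
apply: cvgM; first by apply: cvg_entry; exact: cY.
apply: cvg_C1_derive; [exact/smooth_C1/smooth_derive|exact: cont_p|exact: cont_p'].
Qed.

Section Variation.
Variable B : R -> 'M[R]_n.
Hypotheses (sB : smooth_curve D B) (cB : forall t, D t -> constraint K (B t)).
Let dA (t : R) := ddt D B t + comm (B t) (A t).
Let dh (t : R) := - (invmx (Omega K) *m (B t)^T *m Omega K *m h t).

Lemma cont_B : cont B. Proof. exact: smooth_cont. Qed.

Lemma has_ddt_entry t i j : D t -> has_ddt D (fun s => B s i j : R^o) t (ddt D B t i j).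
Proof.
move=> Dt; rewrite /has_ddt (_ : diff_quot _ t = fun s => diff_quot B t s i j).
  exact: (cvg_entry (smooth_has_ddt sB Dt)).
by apply/funext => s; rewrite /diff_quot !mxE.
Qed.

Lemma dM_ddt_B t : D t -> @dM R n (ddt D B t).
Proof.
move=> Dt; apply/dMP => i.
have H : has_ddt D (fun s => \sum_j B s i j : R^o) t (\sum_j ddt D B t i j).
  by apply: has_ddt_sum => j; exact: has_ddt_entry.
have PD := proper_D T0 Dt.
rewrite -(has_ddt_unique PD H); apply: has_ddt_unique.
apply: (@eq_has_ddt _ _ _ (fun=> 0)) => //.
  by move=> s Ds; have /constraint_dM/dMP -> := cB Ds.
rewrite /has_ddt (_ : diff_quot _ _ = fun=> 0); first exact: cvg_cst.
by apply/funext => s; rewrite /diff_quot subrr scaler0.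
Qed.

Lemma dM_dA t : D t -> @dM R n (dA t).
Proof.
move=> Dt; rewrite /dA -[ddt D B t]scale1r; apply: dM_linear; first exact: dM_ddt_B.
by apply: dM_comm; apply: constraint_dM; [exact: cB|exact: cA].
Qed.

Lemma cont_dA : cont dA.
Proof.
move=> t Dt; apply: cvgD; first exact: smooth_ddt_cont.
by apply: cvg_comm; [exact: cont_B|exact: cont_A].
Qed.

Lemma cont_dh : cont dh.
Proof.
move=> t Dt; apply: cvgN; apply: cvg_mulmx; last exact: cont_h.
apply: cvg_mulmx; last exact: cvg_cst.
by apply: cvg_mulmx; [exact: cvg_cst|apply: cvg_trmx; exact: cont_B].
Qed.

(** Differentiate under the integral sign; the derivative in the direction
    [(dA, dh)] splits into the two functional derivatives. *)
Lemma first_variationE : first_variation l T A h dA dh =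
  \int[mu]_(t in D) (pair1 K (M t) (dA t) + pair0 K (F t) (dh t)).
Proof.
rewrite /first_variation.
have -> : (fun e : R^o => (\int[mu]_(t in D) l (A t + e *: dA t) (h t + e *: dh t)) : R^o) =
    (fun e : R^o => (\int[mu]_(t in D) g (p t + e *: (dA t, dh t))) : R^o).
  apply/funext => e; apply: eq_Rintegral => t; rewrite inE => Dt.
  rewrite /g /ext_lagrangian /= proj_dM_id // addrC.
  by apply: dM_linear; [exact: dM_dA|exact/constraint_dM/cA].
rewrite (derive1_integral T0 Cg cont_g cont_p); last first.
  by move=> t Dt; exact: (cvg_pair (cont_dA Dt) (cont_dh Dt)).
apply: eq_Rintegral => t; rewrite inE => Dt.
rewrite (pair1_M Dt (dM_dA Dt)) (pair0_F (dh t) Dt).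
rewrite -(C1_deriveD (p t) (dA t, 0) (0, dh t) Cg); congr ('D_ _ _ _).
by rewrite [RHS]surjective_pairing /= addr0 add0r.
Qed.

(** A product rule although [M] itself, being a choice of representatives, need not
    be differentiable: expand [B] in a basis and differentiate each pairing. *)
Lemma has_ddt_pair1_M t : D t -> has_ddt D (fun s => pair1 K (M s) (B s) : R^o) t
  (pair1 K (M t) (ddt D B t) + pair1 K (Mdot t) (B t)).
Proof.
move=> Dt.
have dB s : D s -> @dM R n (B s) by move=> Ds; exact/constraint_dM/cB.
apply: (@eq_has_ddt _ _ _ (fun s => \sum_i \sum_j
    B s i j * pair1 K (M s) (proj_dM (delta_mx i j)))) => //.
  by move=> s Ds; rewrite -pair1_dM_sum //; exact: dB.
rewrite (pair1_dM_sum K (M t) (dM_ddt_B Dt)) (pair1_dM_sum K (Mdot t) (dB t Dt)).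
rewrite -big_split; apply: has_ddt_sum => i.
rewrite -big_split; apply: has_ddt_sum => j /=.
apply: has_ddtM; first exact: has_ddt_entry.
rewrite (pair1_Mdot Dt (dM_proj (delta_mx i j))).
exact: (has_ddt_M Dt (dM_proj (delta_mx i j))).
Qed.

(** The variation of [h] is dual to the outer product: both sides are a sum over
    [h i * F j * tri_area K i * B i j]. *)
Lemma pair1_outer t :
  pair1 K (h t *m (F t)^T) (B t) = - pair0 K (F t) (dh t).
Proof.
have OU : Omega K \in unitmx.
  rewrite unitmxE /Omega det_diag unitfE prodf_seq_neq0; apply/allP => i _ /=.
  by rewrite mxE area_neq0.
have Oh i : (Omega K *m h t) i ord0 = tri_area K i * h t i ord0.
  by rewrite /Omega mul_diag_mx !mxE.
have -> : - pair0 K (F t) (dh t) = ((F t)^T *m ((B t)^T *m (Omega K *m h t))) ord0 ord0.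
  rewrite /pair0 /dh mulmxN mxE opprK -!mulmxA; congr ((_ *m _) _ _).
  by rewrite (mulmxA (Omega K)) mulmxV // mul1mx.
rewrite pair1E mxE exchange_big /=; apply: eq_bigr => j _.
rewrite [in RHS]mxE [X in _ * X]mxE mulr_sumr; apply: eq_bigr => i _.
by rewrite Oh mxE big_ord1 !mxE; ring.
Qed.

End Variation.

(** The chosen representative [M t] of the momentum need not depend continuously
    on [t]; this one does. *)
Let Mc (t : R) : 'M[R]_n :=
  \matrix_(i, j) (pair1 K (M t) (proj_dM (delta_mx i j)) / tri_area K i).

Lemma dM_dual_eq_Mc t : dM_dual_eq K (M t) (Mc t).
Proof.
move=> Y dY; rewrite (pair1_dM_sum _ _ dY) pair1E.
apply: eq_bigr => i _; apply: eq_bigr => j _.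
by rewrite mxE divfK ?area_neq0 // mulrC.
Qed.

Lemma cont_Mc : cont Mc.
Proof.
move=> t Dt; apply: cvg_mx => i j; rewrite mxE; under eq_fun do rewrite mxE.
apply: cvgM; last exact: cvg_cst.
apply: (@cont_pair1_M (fun=> proj_dM (delta_mx i j))) => // [s _|s _].
  exact: dM_proj.
exact: cvg_cst.
Qed.

(** The gradient of [C] at [M t] equals that at [Mc t]. *)
Lemma cont_dC : cont (fun t => dC_dM K C (M t) (h t)).
Proof.
apply: (@eq_cont_on _ _ _ (fun t => \matrix_(i, j)
  ((tri_area K i)^-1 * 'D_(delta_mx i j, 0) (uncurryV C) (Mc t, h t)))).
  move=> t Dt; apply/matrixP => i j; rewrite mxE.
  rewrite -(derive_dual_eq _ _ sC (dM_dual_eq_Mc t)).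
  by rewrite -(dC_dMP (M t) (h t) sC).2 pair1_delta mulKf ?area_neq0.
move=> t Dt; apply: cvg_mx => i j; rewrite mxE; under eq_fun do rewrite mxE.
apply: cvgM; first exact: cvg_cst.
apply: cvg_C1_derive; [exact: smooth_C1 sC.2| |exact: cvg_cst].
exact: (cvg_pair (cont_Mc Dt) (cont_h Dt)).
Qed.

Lemma cont_X : cont X.
Proof.
have dD t : @dM R n (dC_dM K C (M t) (h t)) := (dC_dMP (M t) (h t) sC).1.
rewrite XE => t Dt; apply: (cvg_bracket brK) => //.
- by rewrite near_withinE; apply: nearW => s Ds; split; [exact: dD|exact: cA].
- exact: cA.
- exact: cont_dC.
- exact: cont_A.
Qed.

Section Identity.
Variable B : R -> 'M[R]_n.
Hypotheses (sB : smooth_curve D B) (cB : forall t, D t -> constraint K (B t)).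
Let dA (t : R) := ddt D B t + comm (B t) (A t).
Let dh (t : R) := - (invmx (Omega K) *m (B t)^T *m Omega K *m h t).
Let J1 (t : R) := pair1 K (M t) (dA t) + pair0 K (F t) (dh t).
Let J2 (t : R) := gamma K (h t) (X t) (comm (A t) (B t)).
Let N (t : R) := pair1 K (M t) (ddt D B t) + pair1 K (Mdot t) (B t).

Let dB t : D t -> @dM R n (B t).
Proof. by move=> Dt; exact/constraint_dM/cB. Qed.

Lemma cont_J1 : cont J1.
Proof.
apply: contD; first by apply: cont_pair1_M; [exact: dM_dA|exact: cont_dA].
apply: (@eq_cont_on _ _ _ (fun t => 'D_(0, dh t) g (p t))).
  by move=> t Dt; rewrite pair0_F.
move=> t Dt; apply: cvg_C1_derive => //; first exact: cont_p.
exact: (cvg_pair (cvg_cst _) (cont_dh sB Dt)).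
Qed.

Lemma cont_J2 : cont J2.
Proof.
move=> t Dt; apply: cvg_gamma; [exact: cont_h|exact: cont_X|].
by apply: cvg_comm; [exact: cont_A|exact: cont_B].
Qed.

Lemma cont_N : cont N.
Proof.
apply: contD.
  by apply: cont_pair1_M; [exact: dM_ddt_B|exact: smooth_ddt_cont].
by apply: cont_pair1_Mdot; [exact: dB|exact: cont_B].
Qed.

(** [N] is the total derivative of the pairing of [M] with [B], and
    [J1 + theta * J2] is the integrand of the variational principle. *)
Lemma pair1_ZE t : D t -> pair1 K (Z t) (B t) = N t - (J1 t + theta * J2 t).
Proof.
move=> Dt; have dBt := dB Dt; have dAt := constraint_dM (cA Dt).
have subE L L' Y : pair1 K (L - L') Y = pair1 K L Y - pair1 K L' Y.
  by have := pair1_linearl K (-1) L' L Y; rewrite scaleN1r mulN1r addrC => ->; rewrite addrC.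
have addE L L' Y : pair1 K (L + L') Y = pair1 K L Y + pair1 K L' Y.
  by have := pair1_linearl K 1 L L' Y; rewrite scale1r mul1r.
have scaleE a L Y : pair1 K (a *: L) Y = a * pair1 K L Y.
  by have := pair1_linearl K a L 0 Y; rewrite addr0 => ->;
     rewrite /pair1 trmx0 !mul0mx mxtrace0 addr0.
rewrite ZE addE subE addE scaleE !pair1_lie_derivative // pair1_outer.
have -> : J1 t = pair1 K (M t) (ddt D B t) - pair1 K (M t) (comm (A t) (B t))
    + pair0 K (F t) (dh t).
  rewrite /J1 /dA commC; congr (_ + _).
  have := pair1_linearr K (M t) (-1) (comm (A t) (B t)) (ddt D B t).
  by rewrite scaleN1r mulN1r addrC => ->; rewrite addrC.
rewrite /N /J2 /gamma -/(dh t); ring.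
Qed.

(** The continuity that the fundamental lemma asks for: there [B] is a constant
    curve. *)
Lemma cont_pair1_Z : cont (fun t => pair1 K (Z t) (B t)).
Proof.
apply: (@eq_cont_on _ _ _ (fun t => N t + (-1) * (J1 t + theta * J2 t))).
  by move=> t Dt; rewrite pair1_ZE // mulN1r.
apply: contD; first exact: cont_N.
apply: contM; first exact: cont_cst.
by apply: contD; [exact: cont_J1|apply: contM; [exact: cont_cst|exact: cont_J2]].
Qed.

(** The integral of the total derivative [N] is a boundary term, and it vanishes
    with [B]. *)
Lemma variation_integral : B 0 = 0 -> B T = 0 ->
  first_variation l T A h dA dh + theta * (\int[mu]_(t in D) J2 t) =
  - \int[mu]_(t in D) pair1 K (Z t) (B t).
Proof.
move=> B0 BT; rewrite first_variationE //.
have iJ1 := cont_integrable cont_J1.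
have iJ2 := cont_integrable cont_J2.
have cJ : cont (fun t => J1 t + theta * J2 t).
  by apply: contD; [exact: cont_J1|apply: contM; [exact: cont_cst|exact: cont_J2]].
have iJ := cont_integrable cJ.
have iN := cont_integrable cont_N.
have itJ2 : mu.-integrable D (EFin \o (fun t => theta * J2 t)).
  by apply: cont_integrable; apply: contM; [exact: cont_cst|exact: cont_J2].
rewrite -(RintegralZl theta (measurable_D (T := T)) iJ2).
rewrite -(RintegralD (measurable_D (T := T)) iJ1 itJ2).
have -> : \int[mu]_(t in D) pair1 K (Z t) (B t) =
    \int[mu]_(t in D) (N t - (J1 t + theta * J2 t)).
  by apply: eq_Rintegral => t; rewrite inE => Dt; rewrite pair1_ZE.
rewrite (RintegralB (measurable_D (T := T)) iN iJ).
rewrite (FTC_within T0 (has_ddt_pair1_M sB cB) cont_N) B0 BT.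
by rewrite /pair1 !mulmx0 !mxtrace0 subrr sub0r opprK.
Qed.

End Identity.

(** Test with the polynomial multiples of a fixed matrix in one direction; in the
    other, <Z, B> vanishes at every time. *)
Lemma critical_iff :
  (forall B : R -> 'M[R]_n, smooth_curve D B -> (forall t, D t -> constraint K (B t)) ->
     B 0 = 0 -> B T = 0 ->
     first_variation l T A h (fun t => ddt D B t + comm (B t) (A t))
         (fun t => - (invmx (Omega K) *m (B t)^T *m Omega K *m h t))
       + theta * (\int[mu]_(t in D) gamma K (h t) (X t) (comm (A t) (B t))) = 0)
  <-> (forall t, D t -> forall i j, j \in nbr K i -> Pmap (Z t) i j = 0).
Proof.
split=> [crit|PZ B sB cB B0 BT].
  suff Z0 E : constraint K E -> forall t, D t -> pair1 K (Z t) E = 0.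
    by move=> t Dt; apply/pair1_constraint0 => E cE; exact: Z0.
  move=> cE; have scale_cE a : constraint K (a *: E).
    by rewrite -[a *: E]addr0; apply: constraint_linear => //; exact: constraint0.
  have polyE (q : {poly R}) t : pair1 K (Z t) (q.[t] *: E) = q.[t] * pair1 K (Z t) E.
    have := pair1_linearr K (Z t) q.[t] E 0; rewrite addr0 => ->.
    by rewrite /pair1 mulmx0 mxtrace0 addr0.
  apply: (poly_test_eq0 T0).
    apply: (@eq_cont_on _ _ _ (fun t => pair1 K (Z t) ((1 : {poly R}).[t] *: E))).
      by move=> t Dt; rewrite hornerC scale1r.
    apply: cont_pair1_Z; first exact: smooth_curve_poly.
    by move=> t Dt; exact: scale_cE.
  move=> q q0 qT.
  have sB : smooth_curve D (fun t => q.[t] *: E) by exact: smooth_curve_poly.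
  have cB t : D t -> constraint K (q.[t] *: E) by move=> _; exact: scale_cE.
  have B0 : q.[0] *: E = 0 by rewrite q0 scale0r.
  have BT : q.[T] *: E = 0 by rewrite qT scale0r.
  have := variation_integral sB cB B0 BT; rewrite (crit _ sB cB B0 BT).
  move=> /esym /eqP; rewrite oppr_eq0 => /eqP IE; rewrite -[RHS]IE.
  by apply: eq_Rintegral => t _; rewrite polyE.
rewrite variation_integral //; apply/eqP; rewrite oppr_eq0; apply/eqP.
rewrite (_ : \int[mu]_(t in D) _ = \int[mu]_(t in D) 0).
  by rewrite (Rintegral_cst _ (measurable_D (T := T))) mul0r.
apply: eq_Rintegral => t; rewrite inE => Dt.
have /pair1_constraint0 := PZ t Dt; apply; exact: cB.
Qed.

End EulerPoincare.

Theorem theorem3 (R : realType) (n : nat) (K : mesh R n)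
  (br : 'M[R]_n -> 'M[R]_n -> 'M[R]_n)
  (l C : 'M[R]_n -> 'cV[R]_n -> R) (theta T : R)
  (A : R -> 'M[R]_n) (h : R -> 'cV[R]_n) :
  discrete_commutator K br ->
  smooth_lagrangian l ->
  smooth_casimir K C ->
  0 < theta ->
  0 < T ->
  smooth_curve `[0, T]%classic A ->
  (forall t, t \in `[0, T] -> constraint K (A t)) ->
  smooth_curve `[0, T]%classic h ->
  let M := fun t => dl_dA K l (A t) (h t) in
  let X := fun t => br (dC_dM K C (M t) (h t)) (A t) in
  (forall B : R -> 'M[R]_n,
     smooth_curve `[0, T]%classic B ->
     (forall t, t \in `[0, T] -> constraint K (B t)) ->
     B 0 = 0 -> B T = 0 ->
     let dA := fun t => ddt `[0, T]%classic B t + comm (B t) (A t) in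
     let dh := fun t => - (invmx (Omega K) *m (B t)^T *m Omega K *m h t) in
     first_variation l T A h dA dh
       + theta * (\int[lebesgue_measure]_(t in `[0, T])
                    gamma K (h t) (X t) (comm (A t) (B t))) = 0)
  <->
  (forall t, t \in `[0, T] -> forall i j : 'I_n, j \in nbr K i ->
     Pmap (dM_dual_ddt K `[0, T]%classic M t
           + lie_derivative K (A t) (M t)
           - theta *: lie_derivative K (A t) (hmul (h t) (flat K (X t)))
           + h t *m (dl_dh K l (A t) (h t))^T) i j = 0).

Proof.
move=> brK sl sC _ T0 sA cA sh M X.
exact: (critical_iff brK sl sC T0 sA cA sh erefl erefl erefl erefl erefl).
Qed.
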